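(* Let $p$ be a prime, let $k$ be a positive integer, and let $f \in L_2(\mathbb{Q}_p)$ be a compactly supported complex-valued function. Suppose that $\widehat{f}$ is $k$ times pseudo-differentiable. Then $f$ has $k$ $p$-vanishing moments if and only if $(D^{\mu}\widehat{f})(0) = 0$ for all integers $0 \leq \mu < k$.
   Context: $|\cdot|_p$ is the $p$-adic absolute value on $\mathbb{Q}_p$, $\{x\}_p$ is the fractional part of $x\in\mathbb{Q}_p$, $\chi(x,\xi) = e^{2\pi i\{x\xi\}_p}$, and $dx$ is the Haar measure on $\mathbb{Q}_p$ giving $B_0(0)=\{x : |x|_p\le 1\}$ measure $1$. The Fourier transform is $\widehat{f}(\xi) = \int_{\mathbb{Q}_p} f(x)\chi(x,\xi)\,dx$. Pseudo-differential operator: for $\mu>0$, $(D^{\mu}\phi)(x) = \int_{\mathbb{Q}_p} |\xi|_p^{\mu}\,\widehat{\phi}(\xi)\,\chi(x,-\xi)\,d\xi$; $D^0$ is the identity. ''$k$ times pseudo-differentiable'' means that the $D^\mu$ are defined on the function for integers $0\le\mu\le k$. $p$-vanishing moments: a compactly supported $f\in L_2(\mathbb{Q}_p)$ has $k$ $p$-vanishing moments if $\int_{\mathbb{Q}_p} |x|_p^{\mu} f(x)\,dx = 0$ for all integers $0\le \mu<k$ (with $|x|_p^0=1$). *)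

(* Defs.v *)
From HB Require Import structures.
From mathcomp Require Import all_boot all_order all_algebra.
From mathcomp Require Import ring lra zify.
From mathcomp Require Import ring_quotient.
From mathcomp.real_closed Require Import complex.
From mathcomp Require Import all_classical all_reals all_analysis.
Set Implicit Arguments.
Unset Strict Implicit.
Unset Printing Implicit Defensive.
Import Order.TTheory GRing.Theory Num.Theory.
Import numFieldNormedType.Exports.
Local Open Scope classical_set_scope.
Local Open Scope ring_scope.

Definition ratnorm (p : nat) (q : rat) : rat :=
  if q == 0 then 0
  else p%:R ^ ((logn p `|denq q|%N)%:Z - (logn p `|numq q|%N)%:Z).

Section RatNorm.
Variables (p : nat) (p_pr : prime p).
Implicit Types x y q : rat.

Let p_gt0 : 0 < p%:R :> rat. Proof. by rewrite ltr0n prime_gt0. Qed.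
Let p_gt1 : 1 < p%:R :> rat. Proof. by rewrite ltr1n prime_gt1. Qed.

Lemma ratnorm0 : ratnorm p 0 = 0. Proof. by rewrite /ratnorm eqxx. Qed.

Lemma ratnorm_frac (a b : int) : a != 0 -> b != 0 ->
  ratnorm p (a%:~R / b%:~R) =
  p%:R ^ ((logn p `|b|%N)%:Z - (logn p `|a|%N)%:Z).
Proof.
move=> a0 b0; set q : rat := _ / _.
have bq0 : b%:~R != 0 :> rat by rewrite intr_eq0.
have q0 : q != 0 by rewrite mulf_neq0 ?invr_eq0 ?intr_eq0.
rewrite /ratnorm (negbTE q0).
have e : numq q * b = a * denq q.
  apply: (@intr_inj rat); rewrite !intrM numqE.
  rewrite mulrAC /q divfK //.
have n0 : numq q != 0 by rewrite numq_eq0.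
have /(congr1 (fun z : int => logn p `|z|%N)) := e.
rewrite !abszM !lognM ?absz_gt0 ?denq_neq0 // => e'.
congr (_ ^ _); lia.
Qed.

Lemma ratnorm_int (a : int) : a != 0 ->
  ratnorm p a%:~R = p%:R ^ (- (logn p `|a|%N)%:Z).
Proof.
by move=> a0; rewrite -[a%:~R]divr1 (@ratnorm_frac a 1) // logn1 sub0r.
Qed.

Lemma ratnorm_ge0 q : 0 <= ratnorm p q.
Proof. by rewrite /ratnorm; case: ifP => // _; rewrite exprz_ge0 // ltW. Qed.

Lemma ratnorm_eq0 q : (ratnorm p q == 0) = (q == 0).
Proof.
rewrite /ratnorm; case: ifP => [_|_]; first exact: eqxx.
by rewrite expfz_eq0 (gt_eqF p_gt0) andbF.
Qed.

Lemma ratnormM : {morph ratnorm p : x y / x * y}.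
Proof.
move=> x y; have [->|x0] := eqVneq x 0; first by rewrite mul0r ratnorm0 mul0r.
have [->|y0] := eqVneq y 0; first by rewrite mulr0 ratnorm0 mulr0.
rewrite -[x]divq_num_den -[y]divq_num_den mulrACA -invfM -!intrM.
rewrite !ratnorm_frac ?mulf_neq0 ?numq_eq0 ?denq_neq0 //.
rewrite -expfzDr ?gt_eqF //; congr (_ ^ _).
rewrite !abszM !lognM ?absz_gt0 ?numq_eq0 ?denq_neq0 //; lia.
Qed.

Lemma ratnormN q : ratnorm p (- q) = ratnorm p q.
Proof. by rewrite /ratnorm oppr_eq0 numqN denqN abszN. Qed.

Lemma ratnorm1 : ratnorm p 1 = 1.
Proof. by rewrite (@ratnorm_int 1) // logn1. Qed.

Lemma ratnormV q : ratnorm p q^-1 = (ratnorm p q)^-1.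
Proof.
have [->|q0] := eqVneq q 0; first by rewrite !(invr0, ratnorm0).
have n0 : ratnorm p q != 0 by rewrite ratnorm_eq0.
by apply: (mulfI n0); rewrite -ratnormM !divff // ratnorm1.
Qed.

Lemma ratnorm_int_dvd (a : int) (m : nat) : a != 0 ->
  (ratnorm p a%:~R <= p%:R ^ (- m%:Z)) = (p ^ m %| `|a|)%N.
Proof.
move=> a0; rewrite ratnorm_int // ler_eXz2l // lerN2 lez_nat.
by rewrite pfactor_dvdn // absz_gt0.
Qed.

Lemma ratnormD x y : ratnorm p (x + y) <= Num.max (ratnorm p x) (ratnorm p y).
Proof.
wlog xy : x y / ratnorm p x <= ratnorm p y => [hw|].
  have /orP[xy|xy] := le_total (ratnorm p x) (ratnorm p y); first exact: hw.
  by rewrite addrC maxC; apply: hw.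
rewrite le_max; apply/orP; right.
have [->|x0] := eqVneq x 0; first by rewrite add0r.
have [->|s0] := eqVneq (x + y) 0; first by rewrite ratnorm0 ratnorm_ge0.
have y0 : y != 0.
  apply/eqP => y0; move: xy; rewrite y0 ratnorm0 => xy.
  by move/eqP: x0; apply; apply/eqP; rewrite -ratnorm_eq0 eq_le xy ratnorm_ge0.
set d := denq x * denq y.
have d0 : d%:~R != 0 :> rat by rewrite intr_eq0 mulf_neq0 ?denq_neq0.
pose a := numq x * denq y; pose b := numq y * denq x.
have xd : x * d%:~R = a%:~R by rewrite /d /a !intrM numqE mulrA.
have yd : y * d%:~R = b%:~R.
  by rewrite /d /b !intrM numqE [_ * (denq y)%:~R]mulrC mulrA.
have d_gt0 : 0 < ratnorm p d%:~R by rewrite lt_def ratnorm_eq0 d0 ratnorm_ge0.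
have b0 : b != 0 by rewrite mulf_neq0 ?numq_eq0 ?denq_neq0.
have a0 : a != 0 by rewrite mulf_neq0 ?numq_eq0 ?denq_neq0.
rewrite -(ler_pM2r d_gt0) -!ratnormM mulrDl xd yd -intrD.
have ab0 : a + b != 0.
  by rewrite -(intr_eq0 rat) intrD -xd -yd -mulrDl mulf_neq0.
have : ratnorm p a%:~R <= ratnorm p b%:~R.
  by rewrite -xd -yd !ratnormM ler_pM2r.
rewrite [in X in _ <= X -> _](ratnorm_int b0) ratnorm_int_dvd // => pa.
rewrite (ratnorm_int b0) ratnorm_int_dvd //.
have pb : (p ^ logn p `|b| %| `|b|)%N by exact: pfactor_dvdnn.
change ((p ^ logn p `|b|)%N%:Z %| a + b)%Z.
by rewrite rpredD.
Qed.

Lemma ratnormB x y : ratnorm p (x - y) <= Num.max (ratnorm p x) (ratnorm p y).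
Proof. by rewrite -(ratnormN y) ratnormD. Qed.

Lemma ratnorm_distC x y : ratnorm p (x - y) = ratnorm p (y - x).
Proof. by rewrite -ratnormN opprB. Qed.

Lemma ratnorm_lt x y : ratnorm p (x - y) < ratnorm p x ->
  ratnorm p y = ratnorm p x.
Proof.
move=> xy; apply/eqP; rewrite eq_le; apply/andP; split.
  have := ratnormB x (x - y); rewrite subKr => /le_trans; apply.
  by rewrite ge_max lexx ltW.
have := ratnormD (x - y) y; rewrite subrK le_max => /orP[|//].
by rewrite leNgt xy.
Qed.

End RatNorm.

Definition rat_cauchy (p : nat) (u : nat -> rat) : Prop :=
  forall e : rat, 0 < e -> exists N : nat, forall m n : nat,
    (N <= m)%N -> (N <= n)%N -> ratnorm p (u m - u n) < e.

Definition rat_null (p : nat) (u : nat -> rat) : Prop :=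
  forall e : rat, 0 < e -> exists N : nat, forall n : nat,
    (N <= n)%N -> ratnorm p (u n) < e.

Definition cauchy_pred (p : nat) (p_pr : prime p) (u : nat -> rat) : bool :=
  `[< rat_cauchy p u >].

Section CauchyRing.
Variables (p : nat) (p_pr : prime p).
Implicit Types u v : nat -> rat.

Lemma rat_cauchy_bounded u : rat_cauchy p u ->
  exists2 M : rat, 0 < M & forall n, ratnorm p (u n) < M.
Proof.
move=> /(_ 1 ltr01)[N uN].
exists (1 + ratnorm p (u N) + \sum_(i < N) ratnorm p (u i)).
  by rewrite ltr_wpDr ?sumr_ge0 ?ltr_wpDr ?ratnorm_ge0 // => *; rewrite ratnorm_ge0.
move=> n; have [nN|Nn] := ltnP n N.
  rewrite (bigD1 (Ordinal nN)) //= addrCA ltrDl ltr_wpDr //; last first.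
    by rewrite ltr_wpDr ?ratnorm_ge0.
  by rewrite sumr_ge0 // => *; rewrite ratnorm_ge0.
apply: (@lt_le_trans _ _ (1 + ratnorm p (u N))); last first.
  by rewrite lerDl sumr_ge0 // => *; rewrite ratnorm_ge0.
have := ratnormD p_pr (u n - u N) (u N); rewrite subrK le_max => /orP[h|h].
  rewrite (le_lt_trans h) // (lt_le_trans (uN _ _ Nn (leqnn N))) //.
  by rewrite lerDl ratnorm_ge0.
by rewrite (le_lt_trans h) // ltrDr.
Qed.

Lemma cauchy_pred_subring : subring_closed (cauchy_pred p_pr).
Proof.
split.
- apply/asboolP => e e0; exists 0%N => m n _ _.
  by rewrite subrr ratnorm0.
- move=> u v /asboolP uC /asboolP vC; apply/asboolP => e e0.
  have [N uN] := uC e e0; have [M vM] := vC e e0.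
  exists (maxn N M) => m n; rewrite !geq_max => /andP[Nm Mm] /andP[Nn Mn].
  have -> : (u - v) m - (u - v) n = (u m - u n) - (v m - v n).
    by rewrite !fctE; ring.
  by rewrite (le_lt_trans (ratnormB p_pr _ _)) // gt_max uN //= vM.
- move=> u v /asboolP uC /asboolP vC; apply/asboolP => e e0.
  have [A A0 uA] := rat_cauchy_bounded uC.
  have [B B0 vB] := rat_cauchy_bounded vC.
  have [N uN] := uC (e / B) (divr_gt0 e0 B0).
  have [M vM] := vC (e / A) (divr_gt0 e0 A0).
  exists (maxn N M) => m n; rewrite !geq_max => /andP[Nm Mm] /andP[Nn Mn].
  have -> : (u * v) m - (u * v) n = (u m - u n) * v m + u n * (v m - v n).
    by rewrite !fctE; ring.
  rewrite (le_lt_trans (ratnormD p_pr _ _)) // gt_max !ratnormM //.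
  apply/andP; split.
    rewrite -[ltRHS](divfK (lt0r_neq0 B0)).
    by rewrite ltr_pM ?ratnorm_ge0 ?uN ?vB.
  rewrite -[ltRHS](divfK (lt0r_neq0 A0)) mulrC.
  by rewrite ltr_pM ?ratnorm_ge0 ?vM ?uA.
Qed.

End CauchyRing.

HB.instance Definition _ (p : nat) (p_pr : prime p) :=
  GRing.isSubringClosed.Build (nat -> rat) (cauchy_pred p_pr)
    (cauchy_pred_subring p_pr).

Record cauchy_seq (p : nat) (p_pr : prime p) := CauchySeq {
  cseq :> nat -> rat;
  _ : cseq \in cauchy_pred p_pr
}.

HB.instance Definition _ (p : nat) (p_pr : prime p) :=
  [isSub for @cseq p p_pr].
HB.instance Definition _ (p : nat) (p_pr : prime p) :=
  [Choice of cauchy_seq p_pr by <:].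
HB.instance Definition _ (p : nat) (p_pr : prime p) :=
  [SubChoice_isSubComNzRing of cauchy_seq p_pr by <:].

Definition null_pred (p : nat) (p_pr : prime p) (u : cauchy_seq p_pr) : bool :=
  `[< rat_null p u >].

Section NullIdeal.
Variables (p : nat) (p_pr : prime p).

Lemma cauchy_seqP (u : cauchy_seq p_pr) : rat_cauchy p u.
Proof. by case: u => u uC; exact/asboolP. Qed.

Lemma null_pred_ideal : idealr_closed (@null_pred p p_pr).
Proof.
split.
- by apply/asboolP => e e0; exists 0%N => n _; rewrite ratnorm0.
- apply/negP => /asboolP /(_ 1 ltr01) [N /(_ N (leqnn N))].
  by rewrite ratnorm1 // ltxx.
- move=> a u v /asboolP uN /asboolP vN; apply/asboolP => e e0.
  have [A A0 aA] := rat_cauchy_bounded p_pr (cauchy_seqP a).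
  have [N uNe] := uN (e / A) (divr_gt0 e0 A0); have [M vMe] := vN e e0.
  exists (maxn N M) => n; rewrite geq_max => /andP[Nn Mn].
  change ((a * u + v : cauchy_seq p_pr) n) with (a n * u n + v n).
  rewrite (le_lt_trans (ratnormD p_pr _ _)) // gt_max vMe // andbT ratnormM //.
  rewrite -[ltRHS](divfK (lt0r_neq0 A0)) mulrC.
  by rewrite ltr_pM ?ratnorm_ge0 ?uNe ?aA.
Qed.

End NullIdeal.

HB.instance Definition _ (p : nat) (p_pr : prime p) :=
  isIdealr.Build (cauchy_seq p_pr) (@null_pred p p_pr)
    (@null_pred_ideal p p_pr).

(* The completion of the rationals for ratnorm p, as the quotient of the ring of
   Cauchy sequences by the ideal of null sequences. *)
Definition padic (p : nat) (p_pr : prime p) : Type :=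
  {ideal_quot (@null_pred p p_pr : idealr (cauchy_seq p_pr))}.

HB.instance Definition _ (p : nat) (p_pr : prime p) :=
  GRing.ComNzRing.on (padic p_pr).
HB.instance Definition _ (p : nat) (p_pr : prime p) :=
  isPointed.Build (padic p_pr) 0.

Definition rat_lim (u : nat -> rat) (r : rat) : Prop :=
  forall e : rat, 0 < e -> exists N : nat, forall n : nat,
    (N <= n)%N -> `|u n - r| < e.

(* The limit of ratnorm p along a Cauchy sequence representing x. It lies in
   {0} U p^Z, so it is kept rational; padic_norm below is its image in R. *)
Definition padic_abs (p : nat) (p_pr : prime p) (x : padic p_pr) : rat :=
  xget 0 [set r | rat_lim (fun n => ratnorm p (repr x n)) r].

Section PadicAbs.
Variables (p : nat) (p_pr : prime p).
Local Notation Qp := (padic p_pr).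
Local Notation seqp := (cauchy_seq p_pr).
Implicit Types (u v : seqp) (x y : Qp).
Local Open Scope quotient_scope.

Let pi (u : seqp) : Qp := \pi u.

Let piD u v : pi (u + v) = pi u + pi v. Proof. by rewrite /pi !piE. Qed.
Let piM u v : pi (u * v) = pi u * pi v. Proof. by rewrite /pi !piE. Qed.
Let piN u : pi (- u) = - pi u. Proof. by rewrite /pi !piE. Qed.
Let pi1 : pi 1 = 1. Proof. by rewrite /pi !piE. Qed.

Let piP x : exists u, x = pi u.
Proof. by exists (repr x); rewrite /pi reprK. Qed.

Let pi_eq u v : (pi u = pi v) <-> rat_null p (u - v).
Proof.
have e : (pi u == pi v) = (u - v \in @null_pred p p_pr).
  by rewrite Quotient.idealrBE.
split=> [/eqP|uv]; first by rewrite e => /asboolP.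
by apply/eqP; rewrite e; exact/asboolP.
Qed.

Let pi_eq0 u : (pi u = 0) <-> rat_null p u.
Proof.
have <- : pi 0 = 0 by rewrite /pi !piE.
by split=> [/pi_eq|h]; [|apply/pi_eq]; rewrite subr0.
Qed.

Let rat_lim_uniq (w : nat -> rat) r s : rat_lim w r -> rat_lim w s -> r = s.
Proof.
move=> wr ws; apply/eqP; rewrite -subr_eq0 -normr_eq0; apply/eqP.
apply/eqP; rewrite eq_le normr_ge0 andbT leNgt; apply/negP => d0.
have d2 : 0 < `|r - s| / 2 by rewrite divr_gt0.
have [N hN] := wr _ d2; have [M hM] := ws _ d2.
have := hN _ (leq_maxl N M); have := hM _ (leq_maxr N M).
set n := maxn N M => h1 h2.
have : `|r - s| <= `|w n - r| + `|w n - s|.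
  by rewrite -[X in _ <= X + _]normrN (le_trans _ (ler_normD _ _)) // opprB addrA subrK.
rewrite leNgt => /negP; apply; rewrite [ltRHS]splitr; exact: ltrD.
Qed.

Let cauchy_evt u : ~ rat_null p u -> exists2 c : rat, 0 < c &
  exists N, forall n, (N <= n)%N -> ratnorm p (u n) = c.
Proof.
move=> un; have /existsNP[e /not_implyP[e0 /forallNP h]] := un.
have [N uN] := cauchy_seqP u e0.
have /existsNP[n /not_implyP[Nn /negP]] := h N; rewrite -leNgt => en.
exists (ratnorm p (u n)); first exact: lt_le_trans en.
exists N => m Nm; apply: (ratnorm_lt p_pr).
exact: lt_le_trans (uN _ _ Nn Nm) en.
Qed.

Let rat_lim_null u : rat_null p u -> rat_lim (fun n => ratnorm p (u n)) 0.
Proof.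
move=> h e /h[N hN]; exists N => n /hN.
by rewrite subr0 ger0_norm ?ratnorm_ge0.
Qed.

Let rat_lim_evt (w : nat -> rat) c :
  (exists N, forall n, (N <= n)%N -> w n = c) -> rat_lim w c.
Proof. by move=> [N h] e e0; exists N => n /h ->; rewrite subrr normr0. Qed.

Let rat_lim_equiv u v r : rat_null p (u - v) ->
  rat_lim (fun n => ratnorm p (u n)) r -> rat_lim (fun n => ratnorm p (v n)) r.
Proof.
move=> uv ur e e0; have e2 : 0 < e / 2 by rewrite divr_gt0.
have [N hN] := ur _ e2; have [M hM] := uv _ e2.
exists (maxn N M) => n; rewrite geq_max => /andP[Nn Mn].
have {hM} := hM n Mn; change ((u - v) n) with (u n - v n) => uvn.
have {hN} := hN n Nn => un.
have tri a b : ratnorm p (a + b) <= ratnorm p a + ratnorm p b.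
  rewrite (le_trans (ratnormD p_pr _ _)) // ge_max.
  by rewrite lerDl lerDr !ratnorm_ge0.
have h1 := tri (u n - v n) (v n); have h2 := tri (v n - u n) (u n).
rewrite !subrK in h1 h2; rewrite (ratnorm_distC p (v n)) in h2.
move: un; rewrite !ltr_norml => /andP[? ?]; apply/andP; split; lra.
Qed.

Let absP u r : rat_lim (fun n => ratnorm p (u n)) r -> padic_abs (pi u) = r.
Proof.
move=> ur; rewrite /padic_abs; set x := pi u.
have : rat_lim (fun n => ratnorm p (repr x n)) r.
  by apply: rat_lim_equiv ur; apply/pi_eq; rewrite /pi reprK.
move=> h; apply: (@rat_lim_uniq (fun n => ratnorm p (repr x n))) => //.
exact: (xgetPex 0 (ex_intro _ r h)).
Qed.

Let abs_evt u c :
  (exists N, forall n, (N <= n)%N -> ratnorm p (u n) = c) ->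
  padic_abs (pi u) = c.
Proof. by move=> h; apply: absP; exact: rat_lim_evt. Qed.

Let abs_evtN0 u : pi u != 0 -> 0 < padic_abs (pi u) /\
  exists N, forall n, (N <= n)%N -> ratnorm p (u n) = padic_abs (pi u).
Proof.
move=> /eqP u0; have [|c c0 h] := @cauchy_evt u; first by move=> /pi_eq0.
by rewrite (abs_evt h).
Qed.

Lemma padic_abs0 : padic_abs (0 : Qp) = 0.
Proof.
have z : pi 0 = 0 by rewrite /pi !piE.
by rewrite -z; apply: absP; apply: rat_lim_null; apply/pi_eq0.
Qed.

Lemma padic_abs_gt0 x : (0 < padic_abs x) = (x != 0).
Proof.
have [u ->] := piP x; have [->|u0] := eqVneq (pi u) 0.
  by rewrite padic_abs0 ltxx.
by have [->] := abs_evtN0 u0.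
Qed.

Lemma padic_abs_ge0 x : 0 <= padic_abs x.
Proof.
have [->|x0] := eqVneq x 0; first by rewrite padic_abs0.
by rewrite ltW // padic_abs_gt0.
Qed.

Lemma padic_abs_eq0 x : (padic_abs x == 0) = (x == 0).
Proof.
by apply/idP/idP => [|/eqP->]; rewrite ?padic_abs0 //; apply: contraLR;
   rewrite -padic_abs_gt0 lt_def => /andP[].
Qed.

Lemma padic_absD x y :
  padic_abs (x + y) <= Num.max (padic_abs x) (padic_abs y).
Proof.
have [->|x0] := eqVneq x 0; first by rewrite add0r le_max lexx orbT.
have [->|y0] := eqVneq y 0; first by rewrite addr0 le_max lexx.
have [->|s0] := eqVneq (x + y) 0.
  by rewrite padic_abs0 le_max padic_abs_ge0.
have [u xu] := piP x; have [v yv] := piP y; subst x y.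
rewrite -piD in s0 *.
have [_ [N hN]] := abs_evtN0 x0; have [_ [M hM]] := abs_evtN0 y0.
have [_ [K hK]] := abs_evtN0 s0.
pose n := maxn N (maxn M K).
rewrite -(hN n) -?(hM n) -?(hK n) ?leq_max ?leqnn ?orbT //.
exact: (ratnormD p_pr).
Qed.

Lemma padic_absN x : padic_abs (- x) = padic_abs x.
Proof.
have [->|x0] := eqVneq x 0; first by rewrite oppr0.
have [u xu] := piP x; subst x; rewrite -piN.
have [_ [N hN]] := abs_evtN0 x0; apply: abs_evt; exists N => n /hN <-.
by rewrite -[RHS]ratnormN.
Qed.

Lemma padic_absM : {morph @padic_abs p p_pr : x y / x * y}.
Proof.
move=> x y; have [->|x0] := eqVneq x 0; first by rewrite mul0r padic_abs0 mul0r.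
have [->|y0] := eqVneq y 0; first by rewrite mulr0 padic_abs0 mulr0.
have [u xu] := piP x; have [v yv] := piP y; subst x y; rewrite -piM.
have [_ [N hN]] := abs_evtN0 x0; have [_ [M hM]] := abs_evtN0 y0.
apply: abs_evt; exists (maxn N M) => n; rewrite geq_max => /andP[/hN<- /hM<-].
exact: ratnormM.
Qed.

(* inversion: the termwise inverse of a nonnull Cauchy sequence is Cauchy *)
Lemma padic_inv_ex x : x != 0 -> exists y, y * x = 1.
Proof.
have [u ->] := piP x => u0.
have [c0 [N hN]] := abs_evtN0 u0; set c := padic_abs (pi u) in c0 hN *.
have un0 n : (N <= n)%N -> u n != 0.
  by move=> /hN un; rewrite -(ratnorm_eq0 p_pr) un lt0r_neq0.
have vC : (fun n => (u n)^-1) \in cauchy_pred p_pr.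
  apply/asboolP => e e0.
  have [M hM] := cauchy_seqP u (mulr_gt0 e0 (mulr_gt0 c0 c0)).
  exists (maxn N M) => m n; rewrite !geq_max => /andP[Nm Mm] /andP[Nn Mn].
  have um0 := un0 _ Nm; have un0' := un0 _ Nn.
  have -> : (u m)^-1 - (u n)^-1 = (u n - u m) / (u m * u n).
    by field; apply/andP; split.
  rewrite ratnormM // ratnormV // ratnormM // (hN _ Nm) (hN _ Nn).
  by rewrite ltr_pdivrMr ?mulr_gt0 // hM.
exists (pi (CauchySeq vC)); rewrite -piM -pi1; apply/pi_eq => e e0.
exists N => n /un0 n0.
change (ratnorm p ((u n)^-1 * u n - 1) < e).
by rewrite mulVf // subrr ratnorm0.
Qed.

Definition padic_inv x : Qp := xget 0 [set y | y * x = 1].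

Let padic_mulVf x : x != 0 -> padic_inv x * x = 1.
Proof.
by move=> x0; apply: (@xgetPex _ 0 [set y | y * x = 1]); exact: padic_inv_ex.
Qed.

Let padic_invr0 : padic_inv 0 = 0.
Proof.
rewrite /padic_inv xgetPN // => y /=.
by rewrite mulr0 => /esym/eqP; rewrite oner_eq0.
Qed.

HB.instance Definition _ := GRing.ComNzRing_isField.Build (padic p_pr)
  padic_mulVf padic_invr0.

Let cst_cauchy (q : rat) : (fun=> q) \in cauchy_pred p_pr.
Proof.
by apply/asboolP => e e0; exists 0%N => *; rewrite subrr ratnorm0.
Qed.

Let pi_cst (q : rat) : pi (CauchySeq (cst_cauchy q)) = ratr q /\
  zmod_morphism (ratr : rat -> Qp) /\ monoid_morphism (ratr : rat -> Qp).
Proof.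
pose f (q : rat) := pi (CauchySeq (cst_cauchy q)).
have fD : zmod_morphism f.
  move=> a b; rewrite /f -piN -piD; congr pi; exact: val_inj.
have fM : monoid_morphism f.
  split=> [|a b]; first by rewrite /f -pi1; congr pi; exact: val_inj.
  by rewrite /f -piM; congr pi; exact: val_inj.
pose fa := GRing.isZmodMorphism.Build _ _ f fD.
pose fm := GRing.isMonoidMorphism.Build _ _ f fM.
pose F : {rmorphism rat -> Qp} := HB.pack f fa fm.
have fE : f = ratr by apply/funext => r; exact: (fmorph_eq_rat F r).
by rewrite -/(f q) -fE.
Qed.

Lemma padic_ratrB : zmod_morphism (ratr : rat -> Qp).
Proof. exact: (pi_cst 0).2.1. Qed.

Lemma padic_ratrM : monoid_morphism (ratr : rat -> Qp).
Proof. exact: (pi_cst 0).2.2. Qed.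

(* padic_abs extends the absolute value of the rationals, which are dense *)
Lemma padic_abs_rat (q : rat) : padic_abs (ratr q : Qp) = ratnorm p q.
Proof. by rewrite -(pi_cst _).1; apply: abs_evt; exists 0%N. Qed.

Lemma padic_rat_dense x (e : rat) : 0 < e ->
  exists q : rat, padic_abs (x - ratr q) < e.
Proof.
move=> e0; have [u ->] := piP x; have e2 : 0 < e / 2 by rewrite divr_gt0.
have [N hN] := cauchy_seqP u e2.
exists (u N); rewrite -(pi_cst _).1 -piN -piD; set v := (u - _)%R.
have vn n : (N <= n)%N -> ratnorm p (v n) < e / 2.
  by move=> Nn; exact: (hN n N Nn (leqnn N)).
have [->|v0] := eqVneq (pi v) 0; first by rewrite padic_abs0.
have [_ [M hM]] := abs_evtN0 v0.
rewrite -(hM (maxn N M)) ?leq_maxr // (lt_trans (vn _ (leq_maxl _ _))) //.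
by rewrite ltr_pdivrMr // mulr_natr mulr2n ltrDl.
Qed.

End PadicAbs.

(* If x = \sum_(i >= - m) a_i p^i with digits 0 <= a_i < p, its fractional part
   is \sum_(- m <= i < 0) a_i p^i: the only element of Z[1/p] in [0, 1[ whose
   difference with x is a p-adic integer. *)
Definition is_padic_frac (p : nat) (p_pr : prime p) (x : padic p_pr) (r : rat)
    : Prop :=
  [/\ 0 <= r < 1, (exists a m : nat, r = a%:R / p%:R ^+ m)
    & padic_abs (x - ratr r) <= 1].

Definition padic_frac (p : nat) (p_pr : prime p) (x : padic p_pr) : rat :=
  xget 0 [set r | is_padic_frac x r].

Section PadicFrac.
Variables (p : nat) (p_pr : prime p).
Local Notation Qp := (padic p_pr).
Implicit Types (x y : Qp).

Let p0 : p%:R != 0 :> rat. Proof. by rewrite pnatr_eq0 -lt0n prime_gt0. Qed.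

Let pX0 m : p%:R ^+ m != 0 :> rat. Proof. exact: expf_neq0. Qed.

Lemma is_padic_frac_uniq x r s :
  is_padic_frac x r -> is_padic_frac x s -> r = s.
Proof.
move=> [/andP[r0 r1] [a [m ra]] xr] [/andP[s0 s1] [b [n sb]] xs].
have : ratnorm p (r - s) <= 1.
  rewrite -(padic_abs_rat p_pr) padic_ratrB /=.
  have -> : ratr r - ratr s = (x - ratr s) - (x - ratr r) :> Qp by ring.
  by rewrite (le_trans (padic_absD _ _)) // padic_absN ge_max xs xr.
pose c : int := a%:Z * (p ^ n)%:Z - b%:Z * (p ^ m)%N%:Z.
have rs : r - s = c%:~R / (p ^ (m + n))%N%:R.
  rewrite /c ra sb intrB !intrM -!pmulrn !natrX exprD.
  by field; rewrite !pX0.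
rewrite pmulrn in rs.
have pmn : (p ^ (m + n))%N%:Z != 0 by rewrite eqz_nat -lt0n expn_gt0 prime_gt0.
have [c0|c0] := eqVneq c 0.
  by move=> _; apply/eqP; rewrite -subr_eq0 rs c0 mul0r.
rewrite rs ratnormM // ratnormV // ler_pdivrMr; last first.
  by rewrite lt_def ratnorm_eq0 // ratnorm_ge0 // intr_eq0 pmn.
rewrite mul1r [X in _ <= X -> _]ratnorm_int // pfactorK // ratnorm_int_dvd //.
move=> /dvdnP[q cq].
have : `|r - s| < 1 by rewrite ltr_norml; apply/andP; split; lra.
rewrite rs normrM normfV -!intr_norm -abszE cq.
rewrite ltr_pdivrMr ?ltr0z ?normr_gt0 // mul1r ltr_int ltz_nat.
rewrite absz_nat -{2}[(p ^ _)%N]mul1n ltn_mul2r => /andP[_].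
rewrite ltnS leqn0 => /eqP q0; move: cq; rewrite q0 mul0n => /eqP.
by rewrite absz_eq0 (negbTE c0).
Qed.

Lemma is_padic_frac_ex x : exists r, is_padic_frac x r.
Proof.
have [q xq] := padic_rat_dense x ltr01.
pose m := logn p `|denq q|%N; pose b := (`|denq q| %/ p ^ m)%N.
have dN0 : (0 < `|denq q|)%N by rewrite absz_gt0 denq_neq0.
have dE : `|denq q|%N = (b * p ^ m)%N by rewrite divnK // pfactor_dvdnn.
have b0 : (0 < b)%N by move: dN0; rewrite dE muln_gt0 => /andP[].
have cb : coprime b (p ^ m).
  rewrite coprimeXr // coprime_sym prime_coprime //; apply/negP => pb.
  have : (p ^ m.+1 %| `|denq q|)%N by rewrite dE expnS dvdn_mul.
  by rewrite pfactor_dvdn // ltnn.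
have pm0 : (0 < p ^ m)%N by rewrite expn_gt0 prime_gt0.
pose c := (egcdn b (p ^ m)).1.
have [u cu] : exists u : int, (c * b)%:Z = 1 + u * (p ^ m)%N%:Z.
  have := egcdnP (p ^ m) b0; rewrite /c; case: egcdnP => // km kn e _ _ /=.
  by exists kn%:Z; rewrite e (eqP cb) PoszD addrC.
pose t : int := numq q * c%:Z; pose a : int := (t %% (p ^ m)%N%:Z)%Z.
have pmz : (p ^ m)%N%:Z != 0 by rewrite eqz_nat -lt0n.
have a0 : 0 <= a by rewrite modz_ge0.
have am : a < (p ^ m)%N%:Z by rewrite ltz_pmod.
have pmr : (p ^ m)%N%:R != 0 :> rat by rewrite pnatr_eq0 -lt0n.
have rE : (`|a|%N)%:R / p%:R ^+ m = a%:~R / (p ^ m)%N%:R :> rat.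
  by rewrite -[in RHS](gez0_abs a0) -pmulrn natrX.
exists (a%:~R / (p ^ m)%N%:R); split.
- rewrite divr_ge0 ?ler0z ?ler0n //= ltr_pdivrMr ?ltr0n // mul1r.
  by rewrite pmulrn ltr_int.
- by exists `|a|%N, m; rewrite rE.
- have -> : x - ratr (a%:~R / (p ^ m)%N%:R) =
            (x - ratr q) + ratr (q - a%:~R / (p ^ m)%N%:R).
    by rewrite padic_ratrB /= addrA subrK.
  rewrite (le_trans (padic_absD _ _)) // ge_max (ltW xq) /= padic_abs_rat.
  have [v tv] : exists v : int, t = v * (p ^ m)%N%:Z + a.
    by exists (t %/ (p ^ m)%N%:Z)%Z; exact: divz_eq.
  pose w : int := v * b%:Z - numq q * u.
  have br : b%:~R != 0 :> rat by rewrite intr_eq0 eqz_nat -lt0n.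
  have cr : c%:~R = (1 + u%:~R * (p ^ m)%N%:R) / b%:~R :> rat.
    apply: (mulIf br); rewrite divfK // -intrM -PoszM cu intrD intrM.
    by rewrite -pmulrn.
  have dq : (denq q)%:~R = b%:~R * (p ^ m)%N%:R :> rat.
    by rewrite -(gez0_abs (denq_ge0 q)) dE PoszM intrM.
  have -> : q - a%:~R / (p ^ m)%N%:R = w%:~R / b%:~R.
    have -> : a = t - v * (p ^ m)%N%:Z by rewrite tv addrC addKr.
    rewrite -{1}[q]divq_num_den dq /w /t !(intrB, intrM) cr -!pmulrn.
    by field; rewrite pmr [b%:R]pmulrn br.
  have [->|w0] := eqVneq w 0; first by rewrite mul0r ratnorm0.
  rewrite ratnormM // ratnormV // ler_pdivrMr; last first.
    by rewrite lt_def ratnorm_eq0 // ratnorm_ge0 // br.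
  have -> : ratnorm p b%:~R = 1.
    rewrite ratnorm_int ?eqz_nat -?lt0n // absz_nat.
    rewrite (_ : logn p b = 0%N) //; apply/eqP; rewrite -leqn0 leqNgt.
    rewrite -[X in (X < _)%N]/(1.-1)%N /= -pfactor_dvdn //.
    apply/negP => pb; have : (p ^ m.+1 %| `|denq q|)%N.
      by rewrite dE expnS dvdn_mul.
    by rewrite pfactor_dvdn // ltnn.
  by rewrite mul1r -[1]/(p%:R ^ (- 0%:Z)) ratnorm_int_dvd // expn0 dvd1n.
Qed.

Lemma padic_fracP x : is_padic_frac x (padic_frac x).
Proof. exact: (xgetPex 0 (is_padic_frac_ex x)). Qed.

End PadicFrac.

Section PadicMetric.
Variables (p : nat) (p_pr : prime p).
Implicit Types x y z : padic p_pr.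

Definition padic_dist x y := padic_abs (x - y).

Let padic_distxx x : padic_dist x x = 0.
Proof. by rewrite /padic_dist subrr padic_abs0. Qed.

Let padic_dist_eq0 x y : padic_dist x y = 0 -> x = y.
Proof. by move/eqP; rewrite padic_abs_eq0 subr_eq0 => /eqP. Qed.

Let padic_dist_sym x y : padic_dist x y = padic_dist y x.
Proof. by rewrite /padic_dist -padic_absN opprB. Qed.

Let padic_dist_triangle y x z :
  padic_dist x z <= padic_dist x y + padic_dist y z.
Proof.
have -> : padic_dist x z = padic_abs ((x - y) + (y - z)).
  by rewrite addrA subrK.
rewrite (le_trans (padic_absD _ _)) // ge_max lerDl lerDr.
by rewrite !padic_abs_ge0.
Qed.

HB.instance Definition _ := isMetric.Build rat (padic p_pr)
  padic_distxx padic_dist_eq0 padic_dist_sym padic_dist_triangle.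

End PadicMetric.

HB.instance Definition _ (p : nat) (p_pr : prime p) :=
  @isMeasurable.Build ((@open (padic p_pr)).-sigma)%mdisp (padic p_pr)
    <<s (@open (padic p_pr)) >> (@sigma_algebra0 _ setT _) (@sigma_algebraC _ _)
    (@sigma_algebra_bigcup _ setT _).

Section Fourier.
Variables (R : realType) (p : nat) (p_pr : prime p).
Local Notation Qp := (padic p_pr).
Local Open Scope complex_scope.

Definition padic_norm (x : Qp) : R := ratr (padic_abs x).

Definition chi (x xi : Qp) : R[i] :=
  let t := 2 * pi * ratr (padic_frac (x * xi)) in cos t +i* sin t.

Variable mu : {measure set Qp -> \bar R}.

(* These conditions determine mu, the Haar measure of total mass 1 on the p-adic
   integers, on the Borel sets. *)
Definition is_haar : Prop :=
  (forall (a : Qp) (A : set Qp), measurable A -> mu [set a + x | x in A] = mu A)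
  /\ mu [set x | padic_norm x <= 1] = 1%E.

Definition cmeasurable (f : Qp -> R[i]) : Prop :=
  measurable_fun setT (fun x => complex.Re (f x)) /\
  measurable_fun setT (fun x => complex.Im (f x)).

Definition cintegrable (D : set Qp) (f : Qp -> R[i]) : Prop :=
  mu.-integrable D (fun x => (complex.Re (f x))%:E) /\
  mu.-integrable D (fun x => (complex.Im (f x))%:E).

Definition cintegral (D : set Qp) (f : Qp -> R[i]) : R[i] :=
  (\int[mu]_(x in D) complex.Re (f x)) +i* (\int[mu]_(x in D) complex.Im (f x)).

Definition sqnormL2 (f : Qp -> R[i]) : \bar R :=
  (\int[mu]_x ((Normc.normc (f x)) ^+ 2)%:E)%E.

Definition inL2 (f : Qp -> R[i]) : Prop :=
  cmeasurable f /\ (sqnormL2 f < +oo)%E.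

(* the support of an element of L2 is defined up to a null set *)
Definition compactly_supported (f : Qp -> R[i]) : Prop :=
  exists2 K : set Qp, compact K & {ae mu, forall x, ~ K x -> f x = 0}.

(* g is the Fourier transform of f in L2: the limit in mean square of the
   integrals over the balls of radius p ^ N *)
Definition is_fourierL2 (f g : Qp -> R[i]) : Prop :=
  [/\ inL2 f, inL2 g &
    sqnormL2 (fun xi => g xi -
      cintegral [set x | padic_norm x <= p%:R ^+ N] (fun x => f x * chi x xi))
    @[N --> \oo] --> 0%E].

Definition has_fourier (f : Qp -> R[i]) : Prop :=
  cintegrable setT f \/ exists g, is_fourierL2 f g.

(* The defining integral if f is integrable, otherwise the extension to L2
   (which determines the transform up to a null set). *)
Definition fourier (f : Qp -> R[i]) : Qp -> R[i] :=
  if `[< cintegrable setT f >]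
  then fun xi => cintegral setT (fun x => f x * chi x xi)
  else xget (fun=> 0) [set g | is_fourierL2 f g].

Definition pseudo_diff_integrand (s : R) (phi : Qp -> R[i]) (x xi : Qp) : R[i] :=
  (padic_norm xi `^ s)%:C * fourier phi xi * chi x (- xi).

Definition pseudo_diff (s : R) (phi : Qp -> R[i]) (x : Qp) : R[i] :=
  if s == 0 then phi x else cintegral setT (pseudo_diff_integrand s phi x).

Definition pseudo_diff_defined (s : R) (phi : Qp -> R[i]) : Prop :=
  s = 0 \/ (has_fourier phi /\
            forall x, cintegrable setT (pseudo_diff_integrand s phi x)).

Definition pseudo_differentiable (k : nat) (phi : Qp -> R[i]) : Prop :=
  forall m : nat, (m <= k)%N -> pseudo_diff_defined m%:R phi.

Definition vanishing_moments (k : nat) (f : Qp -> R[i]) : Prop :=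
  forall m : nat, (m < k)%N ->
    cintegral setT (fun x => (padic_norm x ^+ m)%:C * f x) = 0.

End Fourier.

(* Main.v *)
(**
Over a ball B_n = {|xi|_p <= p^n} the character chi(x, .) integrates to |B_n| if
x lies in B_(-n) and to 0 otherwise, so Fubini gives, for integrable F,
  int_(B_n) F^ = |B_n| int_(B_(-n)) F.
Taking for F the indicator of B_0 yields |B_n| |B_(-n)| = 1; hence, applying the
identity twice, f and its double transform f^^ have the same integral over every
ball centered at 0. If f^ is only square integrable, the identity passes to the
limit from the truncations f^ 1_(B_N), whose transforms have an integral over B_n
that does not depend on N once N >= -n. As |x|_p^m is constant on spheres,
f and f^^ have the same moments, and the m-th moment of f^^ is (D^m f^)(0).
*)

Require Import Defs.
From HB Require Import structures.
From mathcomp Require Import all_boot all_order all_algebra.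
From mathcomp Require Import ring lra zify.
From mathcomp Require finmap.
From mathcomp.real_closed Require Import complex.
From mathcomp Require Import all_classical all_reals all_analysis.
From mathcomp Require Import measurable_realfun.
Set Implicit Arguments.
Unset Strict Implicit.
Unset Printing Implicit Defensive.
Import Order.TTheory GRing.Theory Num.Theory.
Import numFieldNormedType.Exports.
Local Open Scope classical_set_scope.
Local Open Scope ring_scope.

(** * Balls of Q_p *)

Section Padic.
Variables (p : nat) (p_pr : prime p).
Local Notation Qp := (padic p_pr).
Implicit Types x y z : Qp.

(** The exponent is an integer, so that B_n and its dual B_(-n) are both instances. *)
Definition padic_ball (n : int) : set Qp := [set x | padic_abs x <= p%:R ^ n].

Let p_gt0 : 0 < p%:R :> rat. Proof. by rewrite ltr0n prime_gt0. Qed.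
Let p_gt1 : 1 < p%:R :> rat. Proof. by rewrite ltr1n prime_gt1. Qed.
Let pX_gt0 (n : int) : 0 < p%:R ^ n :> rat. Proof. exact: exprz_gt0. Qed.

Lemma padic_absB x y :
  padic_abs (x - y) <= Num.max (padic_abs x) (padic_abs y).
Proof. by rewrite -(padic_absN y) padic_absD. Qed.

(** Ultrametric triangles are isosceles: in x = (x - y) + y the first summand is too small to
    account for the size of x. *)
Lemma padic_abs_lt x y : padic_abs (x - y) < padic_abs x ->
  padic_abs y = padic_abs x.
Proof.
move=> xy; apply/eqP; rewrite eq_le; apply/andP; split.
  have := padic_absB x (x - y); rewrite subKr => /le_trans; apply.
  by rewrite ge_max lexx ltW.
have := padic_absD (x - y) y; rewrite subrK le_max => /orP[|//].
by rewrite leNgt xy.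
Qed.

Lemma ratnorm_expz (n : int) : ratnorm p (p%:R ^ n) = p%:R ^ (- n).
Proof.
have p0 : p%:Z != 0 by rewrite eqz_nat -lt0n prime_gt0.
have h (m : nat) : ratnorm p (p%:R ^+ m) = p%:R ^ (- m%:Z).
  elim: m => [|m IH]; first by rewrite expr0 ratnorm1.
  rewrite exprS ratnormM // IH [p%:R]pmulrn ratnorm_int // absz_nat.
  by rewrite logn_prime // eqxx -expfzDr ?gt_eqF //; congr (_ ^ _); lia.
case: n => m; first exact: h.
by rewrite NegzE -exprnN ratnormV // h opprK -exprnN invrK.
Qed.

Lemma padic_abs_ratr_expz (n : int) :
  padic_abs (ratr (p%:R ^ n) : Qp) = p%:R ^ (- n).
Proof. by rewrite padic_abs_rat ratnorm_expz. Qed.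

Lemma padic_abs1 : padic_abs (1 : Qp) = 1.
Proof. by rewrite -(padic_ratrM p_pr).1 padic_abs_rat ratnorm1. Qed.

Lemma padic_ratrD (q r : rat) : ratr (q + r) = ratr q + ratr r :> Qp.
Proof.
have ratr0 : ratr 0 = 0 :> Qp by rewrite -(subrr 0) padic_ratrB subrr.
by rewrite -{1}[r]opprK padic_ratrB -[in LHS](sub0r r) padic_ratrB ratr0 sub0r opprK.
Qed.

Lemma padic_absV x : padic_abs x^-1 = (padic_abs x)^-1.
Proof.
have [->|x0] := eqVneq x 0; first by rewrite invr0 padic_abs0 invr0.
have n0 : padic_abs x != 0 by rewrite padic_abs_eq0.
by apply: (mulfI n0); rewrite -padic_absM !divff // padic_abs1.
Qed.

(** A rational closer to x than |x|_p has the same absolute value as x, and for a nonzero rational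
    this is a power of p. *)
Lemma padic_abs_expz x : x != 0 -> exists n : int, padic_abs x = p%:R ^ n.
Proof.
rewrite -padic_abs_gt0 => x0; have [q xq] := padic_rat_dense x x0.
have e := padic_abs_lt xq; rewrite -e padic_abs_rat /ratnorm.
case: ifPn => [q0|_]; last by eexists; reflexivity.
by move: x0; rewrite -e (eqP q0) padic_abs_rat ratnorm0 ltxx.
Qed.

Lemma padic_ball0 n : padic_ball n 0.
Proof. by rewrite /padic_ball /= padic_abs0 ltW. Qed.

Lemma padic_ballD n x y : padic_ball n x -> padic_ball n y ->
  padic_ball n (x + y).
Proof.
by move=> xn yn; apply: le_trans (padic_absD _ _) _; rewrite ge_max; apply/andP.
Qed.

Lemma padic_ballN n x : padic_ball n x -> padic_ball n (- x).
Proof. by rewrite /padic_ball /= padic_absN. Qed.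

Lemma padic_ballS (m n : int) : m <= n -> padic_ball m `<=` padic_ball n.
Proof. by move=> mn x /le_trans; apply; rewrite ler_weXz2l // ltW. Qed.

Lemma padic_ballM (m n : int) x y : padic_ball m x -> padic_ball n y ->
  padic_ball (m + n) (x * y).
Proof.
move=> xm yn; rewrite /padic_ball /= padic_absM expfzDr ?gt_eqF //.
by rewrite ler_pM ?padic_abs_ge0.
Qed.

Lemma pexpn_gt (r : rat) : exists n : nat, r < p%:R ^+ n.
Proof.
exists (Num.truncn `|r|).+1.
have -> : p%:R ^+ (Num.truncn `|r|).+1 = (p ^ (Num.truncn `|r|).+1)%N%:R :> rat.
  by rewrite natrX.
apply: le_lt_trans (ler_norm r) _.
apply: lt_le_trans (truncnS_gt _) _.
by rewrite ler_nat ltnW // ltn_expl // prime_gt1.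
Qed.

Lemma padic_ball_cover x : exists n : nat, padic_ball n x.
Proof.
by have [n h] := pexpn_gt (padic_abs x); exists n; exact: ltW.
Qed.

Lemma open_padic (A : set Qp) :
  (forall x, A x -> exists2 e : rat, 0 < e &
     forall y, padic_abs (x - y) < e -> A y) -> open A.
Proof.
move=> h; rewrite openE => x /h[e e0 he].
by apply/nbhs_ballP; exists e.
Qed.

Lemma measurable_open_padic (A : set Qp) : open A -> measurable A.
Proof. exact: (@sub_sigma_algebra _ setT (@open Qp)). Qed.

(** [padic_abs] is locally constant away from 0, so the preimage of a set avoiding 0 is open; if [P]
    contains 0, its complement avoids it. *)
Lemma measurable_padic_abs (P : set rat) :
  measurable [set x : Qp | P (padic_abs x)].
Proof.
have h (Q : set rat) : ~ Q 0 -> measurable [set x : Qp | Q (padic_abs x)].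
  move=> Q0; apply: measurable_open_padic; apply: open_padic => x /= Qx.
  exists (padic_abs x) => [|y /padic_abs_lt -> //].
  by rewrite padic_abs_gt0; apply/eqP => x0; apply: Q0; rewrite x0 padic_abs0 in Qx.
have [P0|] := pselect (P 0); last exact: h.
rewrite -[X in measurable X]setCK; apply: measurableC; exact: (h (~` P)).
Qed.

Lemma measurable_padic_ball n : measurable (padic_ball n).
Proof. exact: (@measurable_padic_abs [set r | r <= p%:R ^ n]). Qed.

Lemma measurable_fun_padic_abs d (T : measurableType d) (phi : rat -> T) :
  measurable_fun setT (fun x : Qp => phi (padic_abs x)).
Proof.
by move=> _ Y _; rewrite setTI; exact: (@measurable_padic_abs (phi @^-1` Y)).
Qed.

Lemma measurable_padic_shift (a : Qp) : measurable_fun setT (fun x => a + x).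
Proof.
apply: (measurability (@open Qp)) => // _ [A oA <-]; rewrite setTI.
apply: measurable_open_padic; apply: open_padic => x /= Ax.
move: oA; rewrite openE => /(_ _ Ax) /nbhs_ballP[e /= e0 he].
exists e => // y xy; apply: he; rewrite /ball /= /padic_dist.
by rewrite opprD addrACA subrr add0r.
Qed.

Lemma bounded_compact_padic (K : set Qp) : compact K ->
  exists n : nat, K `<=` padic_ball n.
Proof.
rewrite compact_cover => /(_ nat setT (fun n => padic_ball n%:Z)) [].
(* As n is natural, B_n has radius at least 1, so the open unit ball around x stays in the group
   B_n. *)
- move=> n _; apply: open_padic => x xn; exists 1 => // y xy.
  have -> : y = x - (x - y) by rewrite subKr.
  apply: padic_ballD => //; apply: padic_ballN.
  by apply/ltW/(lt_le_trans xy); apply: exprn_ege1; exact: ltW.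
- by move=> x _; have [n xn] := padic_ball_cover x; exists n.
- move=> D _ KD; exists (\max_(i <- finmap.enum_fset D) i)%N => x /KD[n /= nD].
  apply: padic_ballS; rewrite lez_nat.
  exact: leq_bigmax_seq.
Qed.

End Padic.

(** * The additive character *)

Section Character.
Variables (R : realType) (p : nat) (p_pr : prime p).
Local Notation Qp := (padic p_pr).
Implicit Types x y xi : Qp.

Let p_gt0 : 0 < p%:R :> rat. Proof. by rewrite ltr0n prime_gt0. Qed.
Let p_gt1 : 1 < p%:R :> rat. Proof. by rewrite ltr1n prime_gt1. Qed.

Lemma padic_fracE x (r : rat) : is_padic_frac x r -> padic_frac x = r.
Proof. exact/is_padic_frac_uniq/padic_fracP. Qed.

Lemma eq_padic_frac x y : padic_ball 0 (x - y) -> padic_frac x = padic_frac y.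
Proof.
move=> xy; have [r01 ram yr] := padic_fracP y.
apply: padic_fracE; split=> //.
rewrite -[x](subrK y) -addrA.
exact: (@padic_ballD _ _ 0).
Qed.

Lemma padic_frac0 : padic_frac (0 : Qp) = 0.
Proof.
apply: padic_fracE; split; rewrite ?lexx ?ltr01 //.
  by exists 0%N, 0%N; rewrite mul0r.
by rewrite sub0r padic_absN padic_abs_rat ratnorm0.
Qed.

Lemma padic_frac_invp : padic_frac (ratr p%:R^-1 : Qp) = p%:R^-1.
Proof.
apply: padic_fracE; split; last by rewrite subrr padic_abs0.
  by rewrite invr_ge0 ltW //= invf_lt1.
by exists 1%N, 1%N; rewrite mul1r.
Qed.

(** The sum of the two fractional parts lies in [0, 2[ and has a power of p as denominator; if it
    reaches 1, a carry is dropped into the integral part. *)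
Lemma padic_fracD x y : padic_frac (x + y) = padic_frac x + padic_frac y \/
  padic_frac (x + y) = padic_frac x + padic_frac y - 1.
Proof.
have [/andP[r0 r1] [a [m ra]] xr] := padic_fracP x.
have [/andP[s0 s1] [b [n sb]] ys] := padic_fracP y.
set r := padic_frac x in r0 r1 ra xr *; set s := padic_frac y in s0 s1 sb ys *.
pose c := (a * p ^ n + b * p ^ m)%N.
have rs : r + s = c%:R / p%:R ^+ (m + n).
  rewrite ra sb /c natrD !natrM !natrX exprD.
  by field; rewrite !expf_neq0 ?gt_eqF.
have xyrs : padic_ball 0 (x + y - ratr (r + s)).
  have -> : x + y - ratr (r + s) = (x - ratr r) + (y - ratr s).
    by rewrite padic_ratrD opprD addrACA.
  exact: (@padic_ballD _ _ 0 _ _ xr ys).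
have [rs1|rs1] := ltP (r + s) 1; [left|right]; apply: padic_fracE; split.
- by rewrite rs1 addr_ge0.
- by exists c, (m + n)%N.
- exact: xyrs.
- by rewrite subr_ge0 rs1 ltrBlDr ltrD.
(* A carry means that the numerator is at least p^(m+n), so the natural-number subtraction in the
   witness is exact. *)
- have pc : (p ^ (m + n) <= c)%N.
    move: rs1; rewrite rs ler_pdivlMr ?exprn_gt0 // mul1r -natrX.
    by rewrite ler_nat.
  exists (c - p ^ (m + n))%N, (m + n)%N.
  by rewrite natrB // natrX rs mulrBl divff // expf_neq0 // gt_eqF.
- rewrite padic_ratrB.
  rewrite opprB addrC -addrA [_ + (x + y)]addrC.
  apply: (@padic_ballD _ _ 0) => //.
  by rewrite /padic_ball /= padic_abs_rat ratnorm1.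
Qed.

(** The argument of the character: [chi R x xi] is cos + i sin of [chi_arg R (x * xi)]. Keeping cos
    and sin apart reduces the work to real integrals. *)
Definition chi_arg x : R := 2 * pi * ratr (padic_frac x).

Lemma chi_argD x y : chi_arg (x + y) = chi_arg x + chi_arg y \/
  chi_arg (x + y) + pi *+ 2 = chi_arg x + chi_arg y.
Proof.
rewrite /chi_arg; have [->|->] := padic_fracD x y; [left|right].
  by rewrite rmorphD mulrDr.
by rewrite rmorphB rmorphD rmorph1 -[pi *+ 2]mulr_natl mulrBr mulrDr mulr1 subrK.
Qed.

Lemma cos_chi_argD x y : cos (chi_arg (x + y)) = cos (chi_arg x + chi_arg y).
Proof. by have [->//|<-] := chi_argD x y; rewrite cosD2pi. Qed.

Lemma sin_chi_argD x y : sin (chi_arg (x + y)) = sin (chi_arg x + chi_arg y).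
Proof. by have [->//|<-] := chi_argD x y; rewrite sinD2pi. Qed.

Lemma eq_chi_arg x y : padic_ball 0 (x - y) -> chi_arg x = chi_arg y.
Proof. by move=> xy; rewrite /chi_arg (eq_padic_frac xy). Qed.

Lemma chi_arg_ball0 x : padic_ball 0 x -> chi_arg x = 0.
Proof.
move=> x0; rewrite (@eq_chi_arg x 0) ?subr0 //.
by rewrite /chi_arg padic_frac0 rmorph0 mulr0.
Qed.

(** The angle is 2 pi / p, and 1 - cos is 2 sin^2 (pi / p) with pi / p strictly between 0 and pi.
    This expresses that the character is nontrivial; for p = 2 the sine would not detect it. *)
Lemma cos_chi_arg_invp : cos (chi_arg (ratr p%:R^-1)) < 1.
Proof.
rewrite /chi_arg padic_frac_invp fmorphV rmorph_nat -mulrA mulr_natl.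
rewrite cos_mulr2n cos2sin2.
have : 0 < sin (pi / p%:R : R).
  have p0 : 0 < p%:R :> R by rewrite ltr0n prime_gt0.
  apply: sin_gt0_pi; rewrite divr_gt0 ?pi_gt0 //= ltr_pdivrMr //.
  by rewrite ltr_pMr ?pi_gt0 // ltr1n prime_gt1.
by move=> /(exprn_gt0 2); lra.
Qed.

(* On [padic_ball M], the map [xi |-> chi x xi] is constant on the balls of
   radius [p ^ -M], which have countably many rational centres. *)
Lemma measurable_chi_arg d (T : measurableType d) (phi : R -> T) :
  measurable_fun setT (fun z : Qp * Qp => phi (chi_arg (z.1 * z.2))).
Proof.
move=> _ Y _; rewrite setTI.
pose A M (q : rat) :=
  [set x : Qp | padic_ball M x /\ Y (phi (chi_arg (x * ratr q)))].
pose C (M : nat) (q : rat) := [set xi : Qp | padic_ball (- M%:Z) (xi - ratr q)].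
have chiE (M : nat) (q : rat) x xi : padic_ball M x -> C M q xi ->
    chi_arg (x * xi) = chi_arg (x * ratr q).
  move=> xM xiq; apply: eq_chi_arg; rewrite -mulrBr.
  by have := padic_ballM xM xiq; rewrite subrr.
rewrite [X in measurable X](_ : _ =
  \bigcup_(M : nat) \bigcup_(q : rat) (A M q `*` C M q)); last first.
  apply/seteqP; split => [[x xi] /= Yz|[x xi] [M _ [q _ [[/= xM Yq] xiq]]]].
    have [M xM] := padic_ball_cover x.
    have [q /ltW qxi] :=
      @padic_rat_dense _ p_pr xi (p%:R ^ - M%:Z) (exprz_gt0 _ p_gt0).
    exists M => //; exists q => //; split; last exact: qxi.
    by split; [exact: xM|rewrite /= -(chiE M q x xi)].
  by rewrite /= (chiE M q).
apply: bigcupT_measurable => M; apply: bigcupT_measurable_rat => q.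
apply: measurableX.
  (* [A M q] is open: if |q|_p <= p^N, moving x by at most p^(-N) changes x q by a p-adic integer
     and keeps x in B_M, as -N <= 0 <= M. *)
  have [N qN] := padic_ball_cover (ratr q : Qp).
  apply: measurable_open_padic; apply: open_padic => x [xM Yx].
  exists (p%:R ^ (- N%:Z)) => [|y xy]; first exact: exprz_gt0.
  have xyN : padic_ball (- N%:Z) (x - y) by exact: ltW.
  split.
    rewrite -[y](subKr x); apply: padic_ballD => //; apply: padic_ballN.
    by apply: padic_ballS xyN; lia.
  rewrite -(@eq_chi_arg (x * ratr q)) // -mulrBl.
  by have := padic_ballM xyN qN; rewrite addNr.
have := @measurable_padic_shift _ p_pr (- ratr q) measurableT _
  (@measurable_padic_ball _ p_pr (- M%:Z)).
by rewrite setTI; congr measurable; apply/seteqP; split => xi; rewrite /C /= addrC.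
Qed.

Lemma measurable_chi_argl d (T : measurableType d) (phi : R -> T) xi :
  measurable_fun setT (fun x : Qp => phi (chi_arg (x * xi))).
Proof.
exact: (measurableT_comp (measurable_chi_arg phi) (measurable_pair2 xi)).
Qed.

Lemma measurable_chi_argr d (T : measurableType d) (phi : R -> T) x :
  measurable_fun setT (fun xi : Qp => phi (chi_arg (x * xi))).
Proof.
exact: (measurableT_comp (measurable_chi_arg phi) (measurable_pair1 x)).
Qed.

(** The fractional part of x has absolute value at most p^n, so it can be written over p^n; this
    leaves p^n cosets of B_0 to cover B_n. *)
Lemma padic_ball_coset (n : nat) x : padic_ball n x ->
  exists2 a : nat, (a < p ^ n)%N &
    padic_ball 0 (x - ratr (a%:R / p%:R ^+ n)).
Proof.
move=> xn; have [/andP[r0 r1] [a [m ra]] xr] := padic_fracP x.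
set r := padic_frac x in r0 r1 ra xr *.
have rn : ratnorm p r <= p%:R ^ n%:Z.
  rewrite -(padic_abs_rat p_pr) -[ratr r](subKr x).
  apply: padic_ballD => //; apply: padic_ballN.
  exact: (@padic_ballS _ _ 0).
have [a0|a0] := eqVneq a 0%N.
  exists 0%N; first by rewrite expn_gt0 prime_gt0.
  by move: xr; rewrite ra a0 !mul0r.
(* As a = r p^m, one has |a p^n|_p = |r|_p p^(-m) p^(-n) <= p^(-m). *)
have pm : (p ^ m %| a * p ^ n)%N.
  have an0 : (a * p ^ n)%N%:Z != 0.
    by rewrite eqz_nat muln_eq0 negb_or a0 -lt0n expn_gt0 prime_gt0.
  rewrite -[(a * _)%N]/(`|(a * p ^ n)%N%:Z|)%N -(ratnorm_int_dvd p_pr) //.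
  rewrite -pmulrn natrM natrX (_ : a%:R = r * p%:R ^+ m); last first.
    by rewrite ra divfK // expf_neq0 // gt_eqF.
  rewrite !ratnormM // !exprnP !ratnorm_expz // mulrAC.
  apply: ler_piMl; first exact/ltW/exprz_gt0.
  by rewrite -invr_expz ler_pdivrMr ?exprz_gt0 // mul1r.
have [c ac] := dvdnP pm.
have rc : r = c%:R / p%:R ^+ n.
  have pX0 i : p%:R ^+ i != 0 :> rat by rewrite expf_neq0 // gt_eqF.
  rewrite ra; apply/eqP; rewrite eqr_div //.
  by rewrite -!natrX -!natrM ac.
exists c; last by rewrite -rc.
by move: r1; rewrite rc ltr_pdivrMr ?exprn_gt0 // mul1r -natrX ltr_nat.
Qed.

End Character.

(** * Integration *)

Section Integration.
Context d (T : measurableType d) (R : realType).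
Implicit Types (mu : {measure set T -> \bar R}) (F G : T -> R).

(** Countable additivity over the fibers of [nu]. In use, [nu] numbers the possible values of
    |x|_p. *)
Lemma eq_Rintegral_fibers mu F G (nu : T -> nat) :
  (forall n, measurable (nu @^-1` [set n])) ->
  mu.-integrable setT (EFin \o F) -> mu.-integrable setT (EFin \o G) ->
  (forall n, \int[mu]_(x in nu @^-1` [set n]) F x =
             \int[mu]_(x in nu @^-1` [set n]) G x) ->
  \int[mu]_x F x = \int[mu]_x G x.
Proof.
move=> mnu iF iG FG; pose A n := nu @^-1` [set n].
have AT : \bigcup_n A n = setT by apply/seteqP; split => // x _; exists (nu x).
have tA : trivIset setT A by move=> i j _ _ [x [<- <-]].
rewrite /Rintegral -AT !integral_bigcup ?AT //; congr fine.
apply: eq_eseriesr => n _.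
have fin H : mu.-integrable setT (EFin \o H) ->
    (\int[mu]_(x in A n) (H x)%:E = (\int[mu]_(x in A n) H x)%:E)%E.
  move=> iH; rewrite /Rintegral fineK //;
  apply: integrable_fin_num; first exact: mnu.
  by apply: integrableS iH => //; exact: mnu.
by rewrite !fin // FG.
Qed.

(** Since the kernel is bounded by 1, |u(x) c(x, y)| has integral at most ||u||_1 m2(B) over T x B,
    so Fubini applies. *)
Lemma Rfubini_kernel d' (U : measurableType d')
    (m1 : {sigma_finite_measure set T -> \bar R})
    (m2 : {sigma_finite_measure set U -> \bar R})
    (u : T -> R) (c : T * U -> R) (B : set U) :
  m1.-integrable setT (EFin \o u) -> measurable_fun setT c ->
  (forall z, `|c z| <= 1) -> measurable B -> (m2 B < +oo)%E ->
  m2.-integrable B (fun y => (\int[m1]_x (u x * c (x, y)))%:E) /\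
  \int[m2]_(y in B) (\int[m1]_x (u x * c (x, y))) =
  \int[m1]_x (u x * \int[m2]_(y in B) c (x, y)).
Proof.
move=> iu mc c1 mB B_fin.
have mu : measurable_fun setT u by apply/measurable_EFinP; exact: measurable_int iu.
pose h (z : T * U) := (u z.1 * c z * \1_B z.2)%:E.
have mh : measurable_fun setT h.
  apply/measurable_EFinP; apply: measurable_funM.
    by apply: measurable_funM => //; exact: measurableT_comp.
  by apply: measurableT_comp => //; exact: measurable_indic.
have ic x : m2.-integrable B (EFin \o (fun y => c (x, y))).
  apply: measurable_bounded_integrable => //.
    by apply: measurable_funTS; apply: measurableT_comp => //.
  by exists 1; split => // M M1 y _; exact: le_trans (c1 _) (ltW M1).
have ih : (m1 \x m2)%E.-integrable setT h.
  apply/integrable12ltyP => //.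
  apply: (@le_lt_trans _ _ (\int[m1]_x (`|u x|%:E * m2 B))%E).
    apply: ge0_le_integral => //.
    - by move=> x _; exact: integral_ge0.
    - apply: (measurable_fun_fubini_tonelli_F (abse \o h)) => //=.
      exact: measurableT_comp.
    - apply: emeasurable_funM => //; apply/measurable_EFinP.
      exact: measurableT_comp.
    - move=> x _.
      rewrite -(integral_cst m2 mB).
      rewrite [leRHS]integral_mkcond; apply: ge0_le_integral => //.
      + by apply: measurableT_comp => //; exact: measurableT_comp.
      + by apply/(measurable_restrictT _ mB).1; apply: measurable_cst.
      + move=> y _; rewrite patchE /h /= normrM.
        rewrite indicE; case: ifP => yB; last by rewrite normr0 mulr0.
        by rewrite normr1 !mulr1 lee_fin normrM ler_piMr.
  rewrite ge0_integralZr //; last first.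
    by apply/measurable_EFinP; exact: measurableT_comp.
  rewrite lte_mul_pinfty //; first exact: integral_ge0.
  exact: (integrable_fin_num measurableT (integrable_abse iu)).
have FE x : fubini_F m2 h x = (u x * \int[m2]_(y in B) c (x, y))%:E.
  rewrite /fubini_F EFinM /Rintegral fineK; last exact: integrable_fin_num (ic x).
  rewrite -(integralZl mB (ic x)) [RHS]integral_mkcond; apply: eq_integral => y _.
  rewrite patchE /h /= indicE; case: ifP => yB; last by rewrite mulr0.
  by rewrite mulr1.
have iuc y : m1.-integrable setT (EFin \o (fun x => u x * c (x, y))).
  apply: le_integrable iu => //.
    apply/measurable_EFinP; apply: measurable_funM => //.
    exact: measurableT_comp.
  by move=> x _; rewrite lee_fin normrM ler_piMr.
have GE y : fubini_G m1 h y =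
    (((fun y => (\int[m1]_x (u x * c (x, y)))) \_ B) y)%:E.
  rewrite /fubini_G patchE; case: ifPn => yB.
    rewrite /Rintegral fineK; last exact: integrable_fin_num (iuc y).
    apply: eq_integral => x _.
    by rewrite /h /= indicE yB mulr1.
  by apply: integral0_eq => x _; rewrite /h /= indicE (negbTE yB) mulr0.
split.
  (* The inner integral is bounded by ||u||_1, hence integrable over a set of finite measure. *)
  apply: measurable_bounded_integrable => //.
    apply/(measurable_restrictT _ mB)/measurable_EFinP.
    by rewrite (_ : _ \o _ = fubini_G m1 h);
      [exact: measurable_fubini_G ih|apply/funext => y; rewrite GE].
  exists (\int[m1]_x `|u x|); split => [|M]; first exact: num_real.
  move=> M1 y _.
  apply: le_trans (ltW M1).
  apply: le_trans (le_normr_Rintegral _ _) _ => //.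
  apply: le_Rintegral => //;
    [exact: integrable_norm (iuc y)|exact: integrable_norm iu|].
  by move=> x _; rewrite normrM ler_piMr.
rewrite Rintegral_mkcond /Rintegral; congr fine.
transitivity (\int[m2]_y fubini_G m1 h y)%E; first by apply: eq_integral => y _.
rewrite -Fubini //; apply: eq_integral => x _; exact: FE.
Qed.

End Integration.

(** * Domination and mean-square limits on sets of finite measure *)

Section Domination.
Context d (T : measurableType d) (R : realType).
Variable mu : {measure set T -> \bar R}.
Implicit Types (F q w : T -> R) (B D : set T).

Lemma integrable_ae_support F B : measurable B -> measurable_fun setT F ->
  mu.-integrable B (EFin \o F) -> {ae mu, forall x, ~ B x -> F x = 0} ->
  mu.-integrable setT (EFin \o F).
Proof.
move=> mB mF iF F0;
have mEF : measurable_fun setT (EFin \o F) by exact/measurable_EFinP.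
apply/integrableP; split => //.
rewrite (@ge0_ae_eq_integral _ _ _ mu setT _
  (fun x => `|((EFin \o F) \_ B) x|%E)) //.
- by move/(integrable_mkcond _ mB)/integrableP : iF => [].
- exact: measurableT_comp.
- apply: measurableT_comp => //; apply/(measurable_restrictT _ mB).
  exact: measurable_funTS.
- apply: filterS F0 => x Fx _; rewrite patchE; case: ifPn => // xB.
  by rewrite /= Fx //; move: xB; rewrite notin_setE.
Qed.

(** The bound is |F| <= 1 + F^2 <= 1 + q. In use, [q] is a squared modulus and [F] a real or
    imaginary part. *)
Lemma integrable_sqr_dominated F q B : measurable B -> (mu B < +oo)%E ->
  measurable_fun setT F -> measurable_fun setT q -> (forall x, F x ^+ 2 <= q x) ->
  (\int[mu]_x (q x)%:E < +oo)%E -> mu.-integrable B (EFin \o F).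
Proof.
move=> mB B_fin mF mq Fq q_fin.
have q0 x : 0 <= q x by apply: le_trans (Fq x); exact: sqr_ge0.
have iq : mu.-integrable setT (EFin \o q).
  apply/integrableP; split; first exact/measurable_EFinP.
  by under eq_integral do rewrite gee0_abs ?lee_fin //.
apply: (@le_integrable _ _ _ mu B mB _ (fun x => (1 + q x)%:E)).
- by apply/measurable_EFinP; exact: measurable_funTS.
- move=> x _; rewrite lee_fin [leRHS]ger0_norm ?addr_ge0 //.
  rewrite ler_norml; have := Fq x.
  by have := sqr_ge0 (F x - 1); have := sqr_ge0 (F x + 1); nra.
- under eq_fun do rewrite EFinD.
  apply: integrableD => //; last exact: integrableS iq.
  apply: (measurable_bounded_integrable (f := cst 1)) => //.
  by exists 1; split => // M M1 _ _ /=; rewrite normr1 ltW.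
Qed.

(* AM-GM: [2 e |w| <= e ^ 2 + w ^ 2] *)
Lemma norm_Rintegral_le_sqr w q D (e : R) : measurable D -> (mu D < +oo)%E ->
  0 <= e -> mu.-integrable D (EFin \o w) -> measurable_fun setT q ->
  (forall x, w x ^+ 2 <= q x) ->
  ((2 * e * `|\int[mu]_(x in D) w x|)%:E <=
   (e ^+ 2)%:E * mu D + \int[mu]_x (q x)%:E)%E.
Proof.
move=> mD D_fin e0 iw mq wq.
have q0 x : 0 <= q x by apply: le_trans (wq x); exact: sqr_ge0.
have iaw := integrable_norm iw.
have mw : measurable_fun D w by apply/measurable_EFinP; exact: measurable_int iw.
have h : (\int[mu]_(x in D) (2 * e * `|w x|)%:E <=
          \int[mu]_(x in D) ((e ^+ 2)%:E + (q x)%:E))%E.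
  apply: ge0_le_integral => //.
  - by move=> x _; rewrite lee_fin !mulr_ge0.
  - apply/measurable_EFinP; apply: measurable_funM => //.
    exact: measurableT_comp.
  - apply/measurable_EFinP; apply: measurable_funD => //.
    exact: measurable_funTS.
  - move=> x _; rewrite -EFinD lee_fin; apply: le_trans (lerD (lexx _) (wq x)).
    have := sqr_ge0 (e - `|w x|); rewrite -(real_normK (num_real (w x))).
    by nra.
apply: (@le_trans _ _ (\int[mu]_(x in D) (2 * e * `|w x|)%:E)%E).
  under eq_integral do rewrite EFinM.
  rewrite integralZl // EFinM lee_pmul //.
  - by rewrite lee_fin mulr_ge0.
  by rewrite EFin_normr_Rintegral // le_abse_integral //; exact/measurable_EFinP.
apply: (le_trans h).
rewrite ge0_integralD //; last first.
- by apply/measurable_EFinP; exact: measurable_funTS.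
- by move=> x _; rewrite lee_fin.
- by move=> x _; rewrite lee_fin sqr_ge0.
have -> : (\int[mu]_(x in D) (e ^+ 2)%:E = (e ^+ 2)%:E * mu D)%E.
  exact: integral_cst.
rewrite leeD2l //.
apply: ge0_subset_integral => //; first exact/measurable_EFinP.
by move=> x _; rewrite lee_fin.
Qed.

(** On a set of finite measure, mean-square convergence to 0 makes the integrals tend to 0, which an
    eventually constant sequence can do only if the constant is 0. *)
Lemma Rintegral_cvg_sqr (w q : nat -> T -> R) D (c : R) (N0 : nat) :
  measurable D -> (mu D < +oo)%E ->
  (forall N, mu.-integrable D (EFin \o w N)) ->
  (forall N, measurable_fun setT (q N)) -> (forall N x, w N x ^+ 2 <= q N x) ->
  (fun N => \int[mu]_x (q N x)%:E)%E @ \oo --> 0%E ->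
  (forall N, (N0 <= N)%N -> \int[mu]_(x in D) w N x = c) -> c = 0.
Proof.
move=> mD D_fin iw mq wq q0 wc.
have D_num : mu D \is a fin_num by rewrite ge0_fin_numE.
(* The unit added to mu(D) absorbs the mean-square error, which is below e^2 for large N. *)
have h (e : R) : 0 < e -> 2 * e * `|c| <= e ^+ 2 * (fine (mu D) + 1).
  move=> e0; have : nbhs (0%E : \bar R) [set y | (y < (e ^+ 2)%:E)%E].
    apply: open_nbhs_nbhs; split; first exact: open_ereal_lt_ereal.
    by rewrite /= lte_fin exprn_gt0.
  move=> /q0 [N1 _ hN]; pose N := maxn N0 N1.
  have qN := hN N (leq_maxr _ _).
  have := norm_Rintegral_le_sqr mD D_fin (ltW e0) (iw N) (mq N) (wq N).
  rewrite wc ?leq_maxl // => /le_trans/(_ (leeD2l _ (ltW qN))).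
  by rewrite -(fineK D_num) -EFinM -EFinD lee_fin mulrDr mulr1.
apply/eqP; rewrite -normr_le0 leNgt; apply/negP => c0.
have v0 : 0 <= fine (mu D) by exact: fine_ge0.
(* This choice of e gives e (mu(D) + 1) = |c|, so [h] becomes 2 e |c| <= e |c|. *)
have e0 : 0 < `|c| / (fine (mu D) + 1) by rewrite divr_gt0 // ltr_wpDl.
have := h _ e0; rewrite expr2 -[X in _ <= X]mulrA divfK; last first.
  by rewrite gt_eqF // ltr_wpDl.
by rewrite -mulrA ger_pMl ?mulr_gt0 // leNgt ltr1n.
Qed.

End Domination.

(** * Haar measure *)

(** A nontrivial rotation fixes only the origin: the linear system has determinant (1 - c)^2 + s^2 =
    2 (1 - c), and is solved by Cramer's rule. *)
Lemma rotation_fixpoint (R : realFieldType) (c s x y : R) :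
  c < 1 -> c ^+ 2 + s ^+ 2 = 1 -> x = c * x - s * y -> y = s * x + c * y ->
  x = 0 /\ y = 0.
Proof.
move=> c1 cs ex ey; have c0 : 2 * (1 - c) != 0.
  by rewrite mulf_neq0 ?subr_eq0 ?gt_eqF.
have cE : 2 * (1 - c) = (1 - c) ^+ 2 + s ^+ 2.
  transitivity (1 + (1 - 2 * c)); first by ring.
  by rewrite -{1}cs; ring.
have e1 : x * (1 - c) + s * y = 0 by rewrite mulrBr mulr1 {1}ex; ring.
have e2 : y * (1 - c) - s * x = 0 by rewrite mulrBr mulr1 {1}ey; ring.
split; apply: (mulIf c0); rewrite mul0r cE.
  transitivity ((1 - c) * (x * (1 - c) + s * y) - s * (y * (1 - c) - s * x)).
    by ring.
  by rewrite e1 e2 !mulr0 subr0.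
transitivity ((1 - c) * (y * (1 - c) - s * x) + s * (x * (1 - c) + s * y)).
  by ring.
by rewrite e1 e2 !mulr0 addr0.
Qed.

Lemma cos_normr_le1 (R : realType) (t : R) : `|cos t| <= 1.
Proof. by rewrite ler_norml cos_geN1 cos_le1. Qed.

Lemma sin_normr_le1 (R : realType) (t : R) : `|sin t| <= 1.
Proof. by rewrite ler_norml sin_geN1 sin_le1. Qed.

Lemma measurable_cos (R : realType) : measurable_fun setT (@cos R).
Proof. exact: continuous_measurable_fun (@continuous_cos R). Qed.

Lemma measurable_sin (R : realType) : measurable_fun setT (@sin R).
Proof. exact: continuous_measurable_fun (@continuous_sin R). Qed.

Section Haar.
Variables (R : realType) (p : nat) (p_pr : prime p).
Local Notation Qp := (padic p_pr).
Variable mu : {measure set Qp -> \bar R}.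
Hypothesis mu_haar : is_haar mu.
Implicit Types (x a : Qp) (n : int).

Let p_gt0 : 0 < p%:R :> rat. Proof. by rewrite ltr0n prime_gt0. Qed.
Let p_gt1 : 1 < p%:R :> rat. Proof. by rewrite ltr1n prime_gt1. Qed.

Local Hint Extern 0 (measurable (padic_ball _)) =>
  exact: measurable_padic_ball : core.

Lemma padic_norm_le (r : rat) :
  [set x : Qp | padic_norm R x <= ratr r] = [set x | padic_abs x <= r].
Proof. by apply/seteqP; split => x; rewrite /padic_norm /= ler_rat. Qed.

Lemma haar_ball0 : mu (padic_ball 0) = 1%E.
Proof.
rewrite -mu_haar.2; congr (mu _); apply/seteqP.
by split => x; rewrite /padic_norm /padic_ball /= expr0z -(ler_rat R) rmorph1.
Qed.

Lemma padic_shift_preimage a (A : set Qp) :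
  (fun x => a + x) @^-1` A = [set - a + x | x in A].
Proof.
apply/seteqP; split => x /=; first by move=> Aax; exists (a + x); rewrite // addKr.
by move=> [y Ay <-]; rewrite addrA subrr add0r.
Qed.

Lemma haar_preimage_shift a (A : set Qp) : measurable A ->
  mu ((fun x => a + x) @^-1` A) = mu A.
Proof. by move=> mA; rewrite padic_shift_preimage mu_haar.1. Qed.

(** For natural m, B_m is covered by p^m translates of B_0, each of measure 1; any B_n lies in such
    a ball. *)
Lemma haar_ball_lty n : (mu (padic_ball n) < +oo)%E.
Proof.
suff h (m : nat) : (mu (padic_ball m) < +oo)%E.
  apply: le_lt_trans (h `|n|%N); apply: le_measure; rewrite ?inE //.
  by apply: padic_ballS; rewrite abszE ler_norm.
pose F i := (fun x : Qp => - ratr (i%:R / p%:R ^+ m) + x) @^-1` padic_ball 0.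
have mF i : measurable (F i).
  by rewrite -[X in measurable X]setTI; exact: measurable_padic_shift.
have sub : padic_ball m `<=` \big[setU/set0]_(i < (p ^ m)%N) F i.
  move=> x /padic_ball_coset[a am xa]; rewrite -bigcup_mkord; exists a => //.
  by rewrite /F /= addrC.
have := @content_subadditive _ _ _ mu (padic_ball m) F (p ^ m)%N.
move=> /(_ (fun i _ => mF i) (@measurable_padic_ball _ _ _) sub) /le_lt_trans; apply.
have muF i : mu (F i) = 1%E.
  by rewrite /F haar_preimage_shift // haar_ball0.
rewrite (eq_bigr (fun=> 1%E)) => [|i _]; last exact: muF.
by rewrite sumEFin ltry.
Qed.

Lemma haar_sigma_finite : sigma_finite setT mu.
Proof.
exists (fun m : nat => padic_ball m).
  by apply/seteqP; split => // x _; have [m xm] := padic_ball_cover x; exists m.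
by move=> m; split => //; exact: haar_ball_lty.
Qed.

Definition haar_sigma_finite_measure : {sigma_finite_measure set Qp -> \bar R} :=
  HB.pack_for {sigma_finite_measure set Qp -> \bar R} (Measure.sort mu)
    (isSFinite.Build _ _ _ _ (sfinite_measure_sigma_finite haar_sigma_finite))
    (isSigmaFinite.Build _ _ _ _ haar_sigma_finite).

(** B_n is a subgroup, so translation by [a] preserves it, and the image of [mu] under translation
    is [mu]. *)
Lemma haar_shift a n (f : Qp -> R) : padic_ball n a -> measurable_fun setT f ->
  mu.-integrable (padic_ball n) (fun x => (f (a + x))%:E) ->
  \int[mu]_(x in padic_ball n) f (a + x) = \int[mu]_(x in padic_ball n) f x.
Proof.
move=> an mf intf; have ms := measurable_padic_shift a.
have shiftE : (fun x => a + x) @^-1` padic_ball n = padic_ball n.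
  apply/seteqP; split => x /= xn; last exact: padic_ballD.
  by rewrite -[x](addKr a); apply: padic_ballD => //; exact: padic_ballN.
rewrite /Rintegral; congr fine; pose phi x := a + x.
transitivity (\int[pushforward mu phi]_(x in padic_ball n) (f x)%:E)%E.
  rewrite (@integral_pushforward _ _ _ _ _ _ ms mu _ (EFin \o f)) ?shiftE //.
  exact/measurable_EFinP.
apply: eq_measure_integral => A mA _; exact: haar_preimage_shift.
Qed.

Let bounded_trig (c : R -> R) x n : (forall t, `|c t| <= 1) ->
  measurable_fun setT c ->
  mu.-integrable (padic_ball n) (fun xi => (c (chi_arg R (x * xi)))%:E).
Proof.
move=> c1 mc; apply: measurable_bounded_integrable => //.
- exact: haar_ball_lty.
- by apply: measurable_funTS; exact: measurable_chi_argr.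
- by exists 1; split => // M M1 y _; exact: le_trans (c1 _) (ltW M1).
Qed.

(** For x in B_(-n) all products x xi are p-adic integers and the character is 1. Otherwise a
    translation inside B_n preserves the pair of integrals and also rotates it nontrivially, so both
    vanish. *)
Lemma haar_integral_chi n x :
  \int[mu]_(xi in padic_ball n) cos (chi_arg R (x * xi)) =
    fine (mu (padic_ball n)) * \1_(padic_ball (- n)) x /\
  \int[mu]_(xi in padic_ball n) sin (chi_arg R (x * xi)) = 0.
Proof.
have [xn|xn] := boolP (x \in padic_ball (- n)); rewrite indicE.
  have arg0 xi : xi \in padic_ball n -> chi_arg R (x * xi) = 0.
    rewrite inE => xin; apply: chi_arg_ball0.
    by rewrite inE in xn; have := padic_ballM xn xin; rewrite addNr.
  rewrite xn; split.
    under eq_Rintegral => xi xin do rewrite arg0 // cos0.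
    by rewrite Rintegral_cst // mul1r mulr1.
  under eq_Rintegral => xi xin do rewrite arg0 // sin0.
  by rewrite Rintegral_cst // mul0r.
rewrite (negbTE xn) mulr0.
have x0 : x != 0.
  by apply: contraNneq xn => ->; rewrite inE; exact: padic_ball0.
(* Chosen so that x xi0 = 1/p. It lies in B_n because |x|_p > p^(-n) forces |x|_p >= p^(1-n), while
   |xi0|_p = p / |x|_p. *)
pose xi0 : Qp := x^-1 * ratr p%:R^-1.
have xi0n : padic_ball n xi0.
  have [m xm] := padic_abs_expz x0.
  rewrite /padic_ball /= /xi0 padic_absM padic_absV xm.
  rewrite -[p%:R^-1]exprN1 padic_abs_ratr_expz opprK invr_expz -expfzDr ?gt_eqF //.
  rewrite ler_eXz2l //.
  move: xn; rewrite notin_setE /padic_ball /= xm => /negP.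
  rewrite -ltNge ltr_eXz2l //; lia.
have xxi0 : x * xi0 = ratr p%:R^-1 by rewrite /xi0 mulVKf.
set t := chi_arg R (ratr p%:R^-1 : Qp).
pose C := \int[mu]_(xi in padic_ball n) cos (chi_arg R (x * xi)).
pose S := \int[mu]_(xi in padic_ball n) sin (chi_arg R (x * xi)).
have argD xi : x * (xi0 + xi) = ratr p%:R^-1 + x * xi by rewrite mulrDr xxi0.
have mC : measurable_fun setT (fun xi => cos (chi_arg R (x * xi))).
  exact: (measurable_chi_argr (@cos R)).
have mS : measurable_fun setT (fun xi => sin (chi_arg R (x * xi))).
  exact: (measurable_chi_argr (@sin R)).
have iC := @bounded_trig cos x n (@cos_normr_le1 R) (@measurable_cos R).
have iS := @bounded_trig sin x n (@sin_normr_le1 R) (@measurable_sin R).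
have [cos1 sin1] := (@cos_normr_le1 R, @sin_normr_le1 R).
have [mcos msin] := (@measurable_cos R, @measurable_sin R).
have i2 (c c' : R -> R) : (forall s, `|c s| <= 1) -> (forall s, `|c' s| <= 1) ->
    measurable_fun setT c' ->
    mu.-integrable (padic_ball n) (fun xi => (c t * c' (chi_arg R (x * xi)))%:E).
  move=> c1 c'1 mc'; apply: (@bounded_trig (fun s => c t * c' s)) => [s|].
    by rewrite normrM mulr_ile1.
  exact: measurable_funM.
have eC : C = cos t * C - sin t * S.
  transitivity (\int[mu]_(xi in padic_ball n) cos (chi_arg R (x * (xi0 + xi)))).
    apply/esym/(haar_shift xi0n mC); under eq_fun do rewrite argD cos_chi_argD.
    apply: (@bounded_trig (fun s => cos (t + s))) => [s|].
      exact: cos_normr_le1.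
    by apply: measurableT_comp => //; exact: measurable_funD.
  under eq_Rintegral do rewrite argD cos_chi_argD cosD.
  rewrite RintegralB //; [|exact: i2|exact: i2].
  by rewrite !RintegralZl.
have eS : S = sin t * C + cos t * S.
  transitivity (\int[mu]_(xi in padic_ball n) sin (chi_arg R (x * (xi0 + xi)))).
    apply/esym/(haar_shift xi0n mS); under eq_fun do rewrite argD sin_chi_argD.
    apply: (@bounded_trig (fun s => sin (t + s))) => [s|].
      exact: sin_normr_le1.
    by apply: measurableT_comp => //; exact: measurable_funD.
  under eq_Rintegral do rewrite argD sin_chi_argD sinD.
  rewrite RintegralD //; [|exact: i2|exact: i2].
  by rewrite !RintegralZl.
exact: rotation_fixpoint (cos_chi_arg_invp R p_pr) (cos2Dsin2 t) eC eS.
Qed.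

End Haar.

(** * Integrals of Fourier transforms over balls *)

Section Duality.
Variables (R : realType) (p : nat) (p_pr : prime p).
Local Notation Qp := (padic p_pr).
Variable mu : {measure set Qp -> \bar R}.
Hypothesis mu_haar : is_haar mu.
Implicit Types (x xi : Qp) (n : int) (u : Qp -> R) (F : Qp -> R[i]).
Local Open Scope complex_scope.

Local Hint Extern 0 (measurable (padic_ball _)) =>
  exact: measurable_padic_ball : core.

Local Notation vol n := (fine (mu (padic_ball n))).

Lemma integrable_mul_chi (c : R -> R) u xi : (forall t, `|c t| <= 1) ->
  measurable_fun setT c -> mu.-integrable setT (EFin \o u) ->
  mu.-integrable setT (fun x => (u x * c (chi_arg R (x * xi)))%:E).
Proof.
move=> c1 mc iu; apply: (le_integrable _ _ _ iu) => //.
  apply/measurable_EFinP; apply: measurable_funM; last exact: measurable_chi_argl.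
  by apply/measurable_EFinP; exact: measurable_int iu.
by move=> x _; rewrite lee_fin normrM ler_piMr.
Qed.

Lemma haar_fubini_chi (c : R -> R) u n : (forall t, `|c t| <= 1) ->
  measurable_fun setT c -> mu.-integrable setT (EFin \o u) ->
  let U xi := \int[mu]_x (u x * c (chi_arg R (x * xi))) in
  mu.-integrable (padic_ball n) (EFin \o U) /\
  \int[mu]_(xi in padic_ball n) U xi =
    \int[mu]_x (u x * \int[mu]_(xi in padic_ball n) c (chi_arg R (x * xi))).
Proof.
move=> c1 mc iu U; pose m := haar_sigma_finite_measure mu_haar.
apply: (@Rfubini_kernel _ _ _ _ _ m m u (fun z => c (chi_arg R (z.1 * z.2)))) => //.
  exact: measurable_chi_arg.
exact: haar_ball_lty.
Qed.

(** The inner integral left by Fubini is vol n times the indicator of B_(-n). *)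
Lemma haar_duality_cos u n : mu.-integrable setT (EFin \o u) ->
  let U xi := \int[mu]_x (u x * cos (chi_arg R (x * xi))) in
  mu.-integrable (padic_ball n) (EFin \o U) /\
  \int[mu]_(xi in padic_ball n) U xi =
    vol n * \int[mu]_(x in padic_ball (- n)) u x.
Proof.
move=> iu U.
have [iU ->] := haar_fubini_chi n (@cos_normr_le1 R) (@measurable_cos R) iu.
split => //.
under eq_Rintegral do rewrite (haar_integral_chi mu_haar n _).1.
rewrite [in RHS]Rintegral_mkcond -RintegralZl //; last first.
  apply: (@eq_integrable _ _ _ mu setT _ ((EFin \o u) \_ (padic_ball (- n)))) => //.
    by move=> x _; rewrite /= !patchE; case: ifP.
  by apply: (integrable_mkcond _ _).1 => //; exact: integrableS iu.
apply: eq_Rintegral => x _; rewrite patchE indicE.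
by case: ifP => _; rewrite ?mulr0 // mulr1 mulrC.
Qed.

Lemma haar_duality_sin u n : mu.-integrable setT (EFin \o u) ->
  let U xi := \int[mu]_x (u x * sin (chi_arg R (x * xi))) in
  mu.-integrable (padic_ball n) (EFin \o U) /\
  \int[mu]_(xi in padic_ball n) U xi = 0.
Proof.
move=> iu U.
have [iU ->] := haar_fubini_chi n (@sin_normr_le1 R) (@measurable_sin R) iu.
split => //.
under eq_Rintegral do rewrite (haar_integral_chi mu_haar n _).2 mulr0.
by rewrite Rintegral_cst // mul0r.
Qed.

(** The duality is evaluated at the indicator of B_0, which is its own cosine transform. *)
Lemma haar_ball_mulN n : vol n * vol (- n) = 1.
Proof.
have vol0 : vol 0 = 1 by rewrite (haar_ball0 mu_haar).
(* The product is symmetric in n and -n; for n >= 0, B_(-n) lies in B_0 and B_0 in B_n, which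
   settles the two intersections below. *)
wlog n0 : n / 0 <= n => [h|].
  have /orP[|n0] := le_total 0 n; first exact: h.
  by rewrite mulrC -[X in _ * fine (mu (padic_ball X))]opprK h // oppr_ge0.
have int1 (B : set Qp) : measurable B -> \int[mu]_(x in B) \1_(padic_ball 0) x =
    fine (mu (B `&` padic_ball 0)).
  by move=> mB; rewrite /Rintegral integral_indic // setIC.
have i1 : mu.-integrable setT (EFin \o \1_(padic_ball 0 : set Qp)).
  apply/integrableP; split.
    by apply/measurable_EFinP; exact: measurable_indic.
  under eq_integral do rewrite /= ger0_norm //.
  by rewrite integral_indic // setIT haar_ball_lty.
have [_] := haar_duality_cos n i1.
rewrite int1 // (_ : _ `&` _ = padic_ball (- n)); last first.
  by apply/setIidPl; apply: padic_ballS; rewrite oppr_le0.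
move=> <-; transitivity (\int[mu]_(xi in padic_ball n) \1_(padic_ball 0) xi).
  apply: eq_Rintegral => xi _.
  transitivity (\int[mu]_(x in padic_ball 0) cos (chi_arg R (xi * x))).
    rewrite [RHS]Rintegral_mkcond; apply: eq_Rintegral => x _.
    by rewrite patchE indicE mulrC [xi * x]mulrC; case: ifP => _;
      rewrite ?mulr1 ?mulr0.
  by rewrite (haar_integral_chi mu_haar 0 xi).1 vol0 mul1r oppr0.
rewrite int1 // (_ : _ `&` _ = padic_ball 0); last first.
  by apply/setIidPr; exact: padic_ballS.
exact: vol0.
Qed.

End Duality.

(** * Ball integrals of transforms of complex functions, integrable or square integrable *)

Section FourierBalls.
Variables (R : realType) (p : nat) (p_pr : prime p).
Local Notation Qp := (padic p_pr).
Variable mu : {measure set Qp -> \bar R}.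
Hypothesis mu_haar : is_haar mu.
Implicit Types (x xi : Qp) (n : int) (F : Qp -> R[i]).
Local Open Scope complex_scope.
Local Notation Re := complex.Re.
Local Notation Im := complex.Im.

Local Hint Extern 0 (measurable (padic_ball _)) =>
  exact: measurable_padic_ball : core.

Local Notation vol n := (fine (mu (padic_ball n))).

Lemma ReM (z w : R[i]) : Re (z * w) = Re z * Re w - Im z * Im w.
Proof. by case: z => a b; case: w => c e. Qed.

Lemma ImM (z w : R[i]) : Im (z * w) = Re z * Im w + Im z * Re w.
Proof. by case: z => a b; case: w => c e. Qed.

Lemma Re_realM (r : R) (z : R[i]) : Re (r%:C * z) = r * Re z.
Proof. by rewrite ReM mul0r subr0. Qed.

Lemma Im_realM (r : R) (z : R[i]) : Im (r%:C * z) = r * Im z.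
Proof. by rewrite ImM mul0r addr0. Qed.

Lemma Re_cintegral (D : set Qp) F :
  Re (cintegral mu D F) = \int[mu]_(x in D) Re (F x).
Proof. by []. Qed.

Lemma Im_cintegral (D : set Qp) F :
  Im (cintegral mu D F) = \int[mu]_(x in D) Im (F x).
Proof. by []. Qed.

Lemma ReB (z w : R[i]) : Re (z - w) = Re z - Re w.
Proof. by case: z => a b; case: w => c e. Qed.

Lemma ImB (z w : R[i]) : Im (z - w) = Im z - Im w.
Proof. by case: z => a b; case: w => c e. Qed.

Lemma normc_sqr (z : R[i]) : Normc.normc z ^+ 2 = Re z ^+ 2 + Im z ^+ 2.
Proof. by case: z => a b; rewrite /= sqr_sqrtr // addr_ge0 // sqr_ge0. Qed.

Lemma complex_ext (z w : R[i]) : Re z = Re w -> Im z = Im w -> z = w.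
Proof. by case: z => a b; case: w => c e /= -> ->. Qed.

Lemma cintegrableS (A B : set Qp) F : measurable A -> measurable B ->
  A `<=` B -> cintegrable mu B F -> cintegrable mu A F.
Proof. by move=> mA mB AB [i1 i2]; split; exact: integrableS AB _. Qed.

(** The first branch of [fourier], isolated so that it also serves the truncations of an L2
    function. *)
Definition fourier_int F xi : R[i] := cintegral mu setT (fun x => F x * chi R x xi).

Lemma fourier_int_Re F xi : cintegrable mu setT F -> Re (fourier_int F xi) =
  \int[mu]_x (Re (F x) * cos (chi_arg R (x * xi))) -
  \int[mu]_x (Im (F x) * sin (chi_arg R (x * xi))).
Proof.
have [cos1 sin1] := (@cos_normr_le1 R, @sin_normr_le1 R).
have [mcos msin] := (@measurable_cos R, @measurable_sin R).
move=> [i1 i2]; rewrite /fourier_int /=; under eq_Rintegral do rewrite ReM.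
by apply: RintegralB => //; exact: integrable_mul_chi.
Qed.

Lemma fourier_int_Im F xi : cintegrable mu setT F -> Im (fourier_int F xi) =
  \int[mu]_x (Re (F x) * sin (chi_arg R (x * xi))) +
  \int[mu]_x (Im (F x) * cos (chi_arg R (x * xi))).
Proof.
have [cos1 sin1] := (@cos_normr_le1 R, @sin_normr_le1 R).
have [mcos msin] := (@measurable_cos R, @measurable_sin R).
move=> [i1 i2]; rewrite /fourier_int /=; under eq_Rintegral do rewrite ImM.
by apply: RintegralD => //; exact: integrable_mul_chi.
Qed.

(** The sine terms integrate to 0 over a ball, so real and imaginary parts do not mix. *)
Lemma fourier_int_ball F n : cintegrable mu setT F ->
  cintegrable mu (padic_ball n) (fourier_int F) /\
  cintegral mu (padic_ball n) (fourier_int F) =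
    (vol n)%:C * cintegral mu (padic_ball (- n)) F.
Proof.
move=> iF; have [i1 i2] := iF.
have [ic1 c1] := haar_duality_cos mu_haar n i1.
have [ic2 c2] := haar_duality_cos mu_haar n i2.
have [is1 s1] := haar_duality_sin mu_haar n i1.
have [is2 s2] := haar_duality_sin mu_haar n i2.
split.
  split; under eq_fun do rewrite ?fourier_int_Re ?fourier_int_Im // ?EFinB ?EFinD.
    exact: integrableB.
  exact: integrableD.
apply: complex_ext; rewrite ?Re_realM ?Im_realM ?Re_cintegral ?Im_cintegral.
  under eq_Rintegral do rewrite fourier_int_Re //.
  by rewrite RintegralB // c1 s2 subr0.
under eq_Rintegral do rewrite fourier_int_Im //.
by rewrite RintegralD // s1 c2 add0r.
Qed.

Lemma inL2_sqnorm F : inL2 mu F -> [/\ measurable_fun setT (fun x => Re (F x)),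
  measurable_fun setT (fun x => Im (F x)) &
  (\int[mu]_x (Re (F x) ^+ 2 + Im (F x) ^+ 2)%:E < +oo)%E].
Proof.
move=> [[mR mI]]; rewrite /sqnormL2.
by under eq_integral do rewrite normc_sqr.
Qed.

Lemma inL2_integrable_ball F n : inL2 mu F -> cintegrable mu (padic_ball n) F.
Proof.
move=> /inL2_sqnorm[mR mI F_fin].
have mq : measurable_fun setT (fun x => Re (F x) ^+ 2 + Im (F x) ^+ 2).
  by apply: measurable_funD; exact: measurable_funX.
have B_fin := haar_ball_lty mu_haar n.
split; apply: (integrable_sqr_dominated _ B_fin _ mq _ F_fin) => // x.
  by rewrite lerDl sqr_ge0.
by rewrite lerDr sqr_ge0.
Qed.

Lemma measurable_fun_on_balls (f : Qp -> R) :
  (forall n : int, mu.-integrable (padic_ball n) (EFin \o f)) ->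
  measurable_fun setT f.
Proof.
move=> fi; have <- : \bigcup_(N : nat) padic_ball N%:Z = [set: Qp].
  by apply/seteqP; split => // x _; have [N xN] := padic_ball_cover x; exists N.
apply/measurable_fun_bigcup => // N.
by apply/measurable_EFinP; exact: measurable_int (fi N).
Qed.

(** The truncations of F to B_N are integrable, so [fourier_int_ball] applies to their transforms,
    and mean-square convergence carries the result over to G. *)
Lemma fourierL2_ball F G n : is_fourierL2 mu F G ->
  cintegral mu (padic_ball n) G = (vol n)%:C * cintegral mu (padic_ball (- n)) F.
Proof.
move=> [F2 G2 FG].
pose FN (N : nat) x := if x \in padic_ball N then F x else 0.
have iFN N : cintegrable mu setT (FN N).
  have [i1 i2] := inL2_integrable_ball N%:Z F2.
  split; [move: i1|move: i2] => /(integrable_mkcond _ (measurable_padic_ball _));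
    by apply: eq_integrable => // x _; rewrite patchE /FN; case: ifP.
have FNE N xi : cintegral mu [set x | padic_norm R x <= p%:R ^+ N]
    (fun x => F x * chi R x xi) = fourier_int (FN N) xi.
  rewrite (_ : [set x | _] = padic_ball N); last first.
    by have := @padic_norm_le R p p_pr (p%:R ^+ N); rewrite rmorphXn /= ratr_nat.
  by rewrite /fourier_int /cintegral; congr (_ +i* _); rewrite Rintegral_mkcond;
    apply: eq_Rintegral => x _; rewrite patchE /FN; case: ifP => //; rewrite mul0r.
(* Once N >= -n, B_(-n) lies in B_N and the truncation is not seen by the integral over B_(-n). *)
have cN (N : nat) : - n <= N%:Z -> cintegral mu (padic_ball n) (fourier_int (FN N)) =
    (vol n)%:C * cintegral mu (padic_ball (- n)) F.
  move=> nN; rewrite (fourier_int_ball n (iFN N)).2; congr (_ * _).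
  rewrite /cintegral; congr (_ +i* _); apply: eq_Rintegral => x;
    by rewrite inE => xn; rewrite /FN ifT // inE; exact: padic_ballS xn.
pose W N xi := G xi - fourier_int (FN N) xi.
pose q N xi := Re (W N xi) ^+ 2 + Im (W N xi) ^+ 2.
have iG m := inL2_integrable_ball m G2.
have iW N m : cintegrable mu (padic_ball m) (W N).
  have [[i1 i2] [j1 j2]] := (iG m, (fourier_int_ball m (iFN N)).1).
  split; under eq_fun do rewrite /W ?ReB ?ImB EFinB; exact: integrableB.
have mq N : measurable_fun setT (q N).
  by apply: measurable_funD; apply: measurable_funX;
    apply: measurable_fun_on_balls => m; have [] := iW N m.
have q0 : (fun N => \int[mu]_x (q N x)%:E)%E @ \oo --> 0%E.
  move: FG; rewrite /sqnormL2; apply: cvg_trans; apply: near_eq_cvg; near=> N.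
  by apply: eq_integral => x _; rewrite normc_sqr FNE.
have B_fin := haar_ball_lty mu_haar n.
have nN0 (N : nat) : (`|n| <= N)%N -> - n <= N%:Z by lia.
(* The difference of the two sides is the integral of [W N] over B_n for every N >= |n|, and [W N]
   tends to 0 in mean square. *)
apply: complex_ext; apply/eqP; rewrite -subr_eq0; apply/eqP.
  apply: (@Rintegral_cvg_sqr _ _ _ mu (fun N x => Re (W N x)) q
    (padic_ball n) _ `|n|%N) => //.
  - by move=> N; have [] := iW N n.
  - by move=> N x; rewrite lerDl sqr_ge0.
  - move=> N /nN0/cN <-; under eq_Rintegral do rewrite /W ReB.
    by apply: RintegralB => //;
      [have [] := iG n|have [[]] := fourier_int_ball n (iFN N)].
apply: (@Rintegral_cvg_sqr _ _ _ mu (fun N x => Im (W N x)) q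
    (padic_ball n) _ `|n|%N) => //.
- by move=> N; have [] := iW N n.
- by move=> N x; rewrite lerDr sqr_ge0.
- move=> N /nN0/cN <-; under eq_Rintegral do rewrite /W ImB.
  by apply: RintegralB => //;
      [have [] := iG n|have [[]] := fourier_int_ball n (iFN N)].
Unshelve. all: by end_near.
Qed.

(** In the L2 branch only the relation [is_fourierL2] is used, so the representative picked by
    [xget] does not matter. *)
Lemma fourier_ball F n : has_fourier mu F ->
  cintegrable mu (padic_ball n) (fourier mu F) /\
  cintegral mu (padic_ball n) (fourier mu F) =
    (vol n)%:C * cintegral mu (padic_ball (- n)) F.
Proof.
move=> hF; rewrite /fourier; case: asboolP => [iF|niF].
  exact: fourier_int_ball.
have hF2 : exists G, is_fourierL2 mu F G by case: hF.
have FG := xgetPex (fun=> 0) hF2; split; last exact: fourierL2_ball FG.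
by apply: inL2_integrable_ball; have [] := FG.
Qed.

(** Two uses of the ball identity, at n and then at -n, produce volume factors whose product is
    1. *)
Lemma fourier_fourier_ball F n : cintegrable mu setT F ->
  has_fourier mu (fourier mu F) ->
  cintegral mu (padic_ball n) (fourier mu (fourier mu F)) =
    cintegral mu (padic_ball n) F.
Proof.
move=> iF hF; rewrite (fourier_ball n hF).2.
rewrite (fourier_ball (- n) (or_introl iF)).2 opprK mulrA -rmorphM /=.
by rewrite haar_ball_mulN // mul1r.
Qed.

End FourierBalls.

(** * Moments *)

Section Moments.
Variables (R : realType) (p : nat) (p_pr : prime p).
Local Notation Qp := (padic p_pr).
Variable mu : {measure set Qp -> \bar R}.
Local Open Scope complex_scope.
Local Notation Re := complex.Re.
Local Notation Im := complex.Im.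

Local Hint Extern 0 (measurable (padic_ball _)) =>
  exact: measurable_padic_ball : core.

Let p_gt0 : 0 < p%:R :> rat. Proof. by rewrite ltr0n prime_gt0. Qed.
Let p_gt1 : 1 < p%:R :> rat. Proof. by rewrite ltr1n prime_gt1. Qed.

(** Nonzero absolute values are powers of p, so |x|_p > p^(z-1) already means |x|_p >= p^z. *)
Lemma padic_sphereE (z : int) :
  [set x : Qp | padic_abs x = p%:R ^ z] = padic_ball z `\` padic_ball (z - 1).
Proof.
apply/seteqP; split => x.
  move=> /= xz; split; rewrite /padic_ball /= xz //.
  by apply/negP; rewrite -ltNge ltr_eXz2l //; lia.
move=> [/= xz]; have [->|x0] := eqVneq x 0; first by case; exact: padic_ball0.
have [y xy] := padic_abs_expz x0.
rewrite /padic_ball /= xy in xz * => /negP; rewrite -ltNge ltr_eXz2l //.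
by rewrite ler_eXz2l // in xz => ?; congr (_ ^ _); lia.
Qed.

(** The weight is constant on each sphere, and a sphere is a difference of two balls, over which u
    and v have equal integrals. *)
Lemma eq_Rintegral_radial (phi : rat -> R) (u v : Qp -> R) : phi 0 = 0 ->
  (forall n, mu.-integrable (padic_ball n) (EFin \o u)) ->
  (forall n, mu.-integrable (padic_ball n) (EFin \o v)) ->
  (forall n, \int[mu]_(x in padic_ball n) u x = \int[mu]_(x in padic_ball n) v x) ->
  mu.-integrable setT (fun x => (phi (padic_abs x) * u x)%:E) ->
  mu.-integrable setT (fun x => (phi (padic_abs x) * v x)%:E) ->
  \int[mu]_x (phi (padic_abs x) * u x) = \int[mu]_x (phi (padic_abs x) * v x).
Proof.
move=> phi0 iu iv uv iphiu iphiv.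
(* Absolute values are rational, hence numbered by [pickle]; each fiber is empty, {0} or a
   sphere. *)
apply: (@eq_Rintegral_fibers _ _ _ mu (fun x => phi (padic_abs x) * u x)
  (fun x => phi (padic_abs x) * v x) (fun x => pickle (padic_abs x))) => //.
  by move=> n; exact: (@measurable_padic_abs _ p_pr [set r | pickle r = n]).
move=> n; set A := _ @^-1` _.
have [[x0 /= x0n]|A0] := pselect (exists x, A x); last first.
  by rewrite (_ : A = set0) ?Rintegral_set0 // -subset0 => x Ax; apply: A0; exists x.
have Aabs x : x \in A -> padic_abs x = padic_abs x0.
  by rewrite inE => xn; apply: (pcan_inj pickleK); rewrite x0n.
(* The fiber {0} is not a difference of two balls; there the weight is [phi 0], which is 0. *)
have [x00|x00] := eqVneq x0 0.
  by apply: eq_Rintegral => x /Aabs ->; rewrite x00 padic_abs0 phi0 !mul0r.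
have [z x0z] := padic_abs_expz x00.
have AE : A = padic_ball z `\` padic_ball (z - 1).
  rewrite -padic_sphereE -x0z; apply/seteqP; split => x.
    by move=> Ax; apply: Aabs; rewrite inE.
  by rewrite /A /= => ->.
have mA : measurable A by rewrite AE; exact: measurableD.
have zz : (padic_ball (z - 1) : set Qp) `<=` padic_ball z by apply: padic_ballS; lia.
have sphere (w : Qp -> R) : (forall n, mu.-integrable (padic_ball n) (EFin \o w)) ->
    \int[mu]_(x in A) (phi (padic_abs x) * w x) =
    phi (padic_abs x0) * (\int[mu]_(x in padic_ball z) w x -
                          \int[mu]_(x in padic_ball (z - 1)) w x).
  move=> iw; have iwA : mu.-integrable A (EFin \o w).
    by apply: integrableS (iw z) => //; rewrite AE => x [].
  transitivity (\int[mu]_(x in A) (phi (padic_abs x0) * w x)).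
    by apply: eq_Rintegral => x /Aabs ->.
  rewrite RintegralZl //; congr (_ * _); apply/esym/eqP; rewrite subr_eq; apply/eqP.
  have zU : padic_ball z = A `|` padic_ball (z - 1).
    by rewrite AE setUC setDUK.
  rewrite {1}zU; apply: Rintegral_setU => //; first by rewrite -zU; exact: iw.
  by rewrite AE; apply/disj_setPS => x [[]].
by rewrite !sphere // !uv.
Qed.

Hypothesis mu_haar : is_haar mu.
Implicit Types F : Qp -> R[i].

Lemma compactly_supported_ball F : compactly_supported mu F ->
  exists N : nat, {ae mu, forall x, ~ padic_ball N x -> F x = 0}.
Proof.
move=> [K cK F0]; have [N KN] := bounded_compact_padic cK; exists N.
by apply: filterS F0 => x Fx xN; apply: Fx => /KN.
Qed.

(** F vanishes almost everywhere outside some B_N; on B_N it is integrable, being in L2, and the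
    weight is at most p^(N m). *)
Lemma integrable_moment F (m : nat) : inL2 mu F -> compactly_supported mu F ->
  cintegrable mu setT (fun x => (padic_norm R x ^+ m)%:C * F x).
Proof.
move=> F2 /compactly_supported_ball[N F0].
have [mR mI _] := inL2_sqnorm F2.
have [iR iI] := inL2_integrable_ball mu_haar N%:Z F2.
suff h (u : Qp -> R) : measurable_fun setT u ->
    mu.-integrable (padic_ball N) (EFin \o u) ->
    {ae mu, forall x, ~ padic_ball N x -> u x = 0} ->
    mu.-integrable setT (fun x => (padic_norm R x ^+ m * u x)%:E).
  split; under eq_fun do rewrite ?Re_realM ?Im_realM; apply: h => //;
    by apply: filterS F0 => x Fx /Fx ->.
move=> mu_ iu u0; have mn : measurable_fun setT (fun x : Qp => padic_norm R x ^+ m).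
  exact: (measurable_fun_padic_abs (fun r => (ratr r : R) ^+ m)).
apply: (@integrable_ae_support _ _ _ mu _ (padic_ball N)) => //.
- exact: measurable_funM.
- apply: (@le_integrable _ _ _ mu _ _ _
    (fun x => ((ratr (p%:R ^ N%:Z) ^+ m)%:E * (u x)%:E)%E)) => //.
  + by apply/measurable_EFinP; apply: measurable_funTS; exact: measurable_funM.
  + move=> x xN; rewrite lee_fin !normrM ler_wpM2r //.
    have n0 : 0 <= padic_norm R x by rewrite ler0q padic_abs_ge0.
    have nN : padic_norm R x <= ratr (p%:R ^ N%:Z) by rewrite ler_rat.
    have P0 := le_trans n0 nN; rewrite !ger0_norm ?exprn_ge0 //.
    by apply: lerXn2r; rewrite ?nnegrE.
  + exact: integrableZl.
- by apply: filterS u0 => x ux /ux ->; rewrite mulr0.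
Qed.

(** At 0 the character in D^m is 1, so for m > 0 the right-hand side is the m-th moment of the
    double transform, to which the radial comparison with F applies. *)
Lemma eq_moment_pseudo_diff F (m : nat) : inL2 mu F -> compactly_supported mu F ->
  pseudo_diff_defined mu m%:R (fourier mu F) ->
  cintegral mu setT (fun x => (padic_norm R x ^+ m)%:C * F x) =
  pseudo_diff mu m%:R (fourier mu F) 0.
Proof.
move=> F2 F_supp hF; have iM := integrable_moment m F2 F_supp.
have iF : cintegrable mu setT F.
  have := integrable_moment 0 F2 F_supp.
  by under eq_fun do rewrite expr0 mul1r.
have chi0 (x : Qp) y : x * y = 0 -> chi R x y = 1.
  move=> xy; apply: complex_ext; rewrite /chi /= xy padic_frac0 rmorph0 mulr0.
    exact: cos0.
  exact: sin0.
(* For m = 0 the operator is the identity, and the transform of the integrable F at 0 is the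
   integral of F. *)
rewrite /pseudo_diff; case: ifPn => [|m0].
  rewrite pnatr_eq0 => /eqP ->; rewrite /fourier asboolT //.
  congr (cintegral _ _ _); apply/funext => x.
  by rewrite expr0 mul1r chi0 ?mulr1 ?mulr0.
case: hF => [/eqP|[hF /(_ 0)]]; first by rewrite (negbTE m0).
have -> : pseudo_diff_integrand mu m%:R (fourier mu F) 0 =
    fun x => (padic_norm R x ^+ m)%:C * fourier mu (fourier mu F) x.
  apply/funext => x; rewrite /pseudo_diff_integrand chi0 ?mul0r // mulr1.
  by rewrite powR_mulrn // ler0q padic_abs_ge0.
move=> iG; set G := fourier mu (fourier mu F).
have GF n := fourier_fourier_ball mu_haar n iF hF.
have iGn n := (fourier_ball mu_haar n hF).1.
have iFn n : cintegrable mu (padic_ball n) F by exact: cintegrableS iF.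
(* This is where m > 0 enters, since 0 ^+ 0 is 1. *)
have phi0 : ratr 0 ^+ m = 0 :> R.
  by rewrite rmorph0 expr0n -(pnatr_eq0 R) (negbTE m0).
have [iG1 iG2] := iG; have [iM1 iM2] := iM.
rewrite /cintegral; congr (_ +i* _).
  under eq_Rintegral do rewrite Re_realM.
  under [RHS]eq_Rintegral do rewrite Re_realM.
  apply: (@eq_Rintegral_radial (fun r => ratr r ^+ m)) => //.
  - by move=> n; have [] := iFn n.
  - by move=> n; have [] := iGn n.
  - by move=> n; rewrite -!Re_cintegral GF.
  - by move: iM1; under eq_fun do rewrite Re_realM.
  - by move: iG1; under eq_fun do rewrite Re_realM.
under eq_Rintegral do rewrite Im_realM.
under [RHS]eq_Rintegral do rewrite Im_realM.
apply: (@eq_Rintegral_radial (fun r => ratr r ^+ m)) => //.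
- by move=> n; have [] := iFn n.
- by move=> n; have [] := iGn n.
- by move=> n; rewrite -!Im_cintegral GF.
- by move: iM2; under eq_fun do rewrite Im_realM.
- by move: iG2; under eq_fun do rewrite Im_realM.
Qed.

End Moments.

Theorem theorem4p1 (R : realType) (p : nat) (p_pr : prime p)
    (mu : {measure set (padic p_pr) -> \bar R}) (mu_haar : is_haar mu)
    (k : nat) (k_gt0 : (0 < k)%N)
    (f : padic p_pr -> R[i]) (f_L2 : inL2 mu f)
    (f_supp : compactly_supported mu f)
    (f_diff : pseudo_differentiable mu k (fourier mu f)) :
  vanishing_moments mu k f <->
  (forall m : nat, (m < k)%N -> pseudo_diff mu m%:R (fourier mu f) 0 = 0).
Proof.
(* Each moment equals the corresponding value at 0, so the two families of conditions agree term by
   term. *)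
have momentE m : (m < k)%N ->
    cintegral mu setT (fun x => ((padic_norm R x ^+ m)%:C * f x)%C) =
    pseudo_diff mu m%:R (fourier mu f) 0.
  by move=> mk; apply: eq_moment_pseudo_diff => //; exact: f_diff (ltnW mk).
by split=> h m mk; [rewrite -momentE|rewrite momentE] => //; exact: h.
Qed.
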